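(* Let $D$ be a Prüfer domain and let $X\subseteq\mathrm{Max}(D)$ be a discrete splitting set of $D$. Then the following are equivalent: (i) $\mathrm{Crit}_X(D)=\emptyset$; (ii) $\mathrm{rad}(I)$ is finitely generated for all proper ideals $I\in\mathrm{Inv}_X(D)$; (iii) every proper ideal $I\in\mathrm{Inv}_X(D)$ can be factored into a finite product of finitely generated radical ideals; (iv) the ideal function $\nu_I\colon X\to\mathbb Z$ of every $I\in\mathrm{Inv}_X(D)$ is continuous.
   Context: $\mathrm{Inv}(D)$ is the group of invertible fractional ideals of $D$. For $X\subseteq\mathrm{Spec}(D)$, $X^\uparrow:=\{P\in\mathrm{Spec}(D)\mid Q\subseteq P\text{ for some }Q\in X\}$. The inverse topology on $\mathrm{Spec}(D)$ is the topology having as a subbasis of open sets the sets $\mathcal V(I)=\{P\in\mathrm{Spec}(D)\mid I\subseteq P\}$, for $I$ a finitely generated ideal. $X$ is a splitting set if $X=X^\uparrow$ and $X$ is open in the inverse topology (equivalently, $X=X^\uparrow$ and $\mathrm{Spec}(D)\setminus X$ is quasi-compact in the Zariski topology); it is discrete if $P\neq P^2$ for every $P\in X$. The support of a fractional ideal $I$ is $\mathrm{supp}(I):=\{P\in\mathrm{Spec}(D)\mid ID_P\neq D_P\}$, and $\mathrm{Inv}_X(D):=\{I\in\mathrm{Inv}(D)\mid\mathrm{supp}(I)\subseteq X\}$. A proper ideal is an integral ideal $I\subsetneq D$. A maximal ideal $M\in X$ is critical with respect to $X$ if there is no radical (integral) ideal $I\in\mathrm{Inv}_X(D)$ with $I\subseteq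 M$; $\mathrm{Crit}_X(D)$ is the set of such $M$. Ideal function: for $P\in X$, $Q:=\bigcap_{n\ge1}P^n$ is the largest prime ideal strictly contained in $P$, and $D_P/QD_P$ is a discrete valuation ring, with normalized valuation $v'_P$, whose quotient field is $D_Q/QD_Q$. If $I\in\mathrm{Inv}_X(D)$, then $QD_P\subsetneq ID_P\subsetneq D_Q$, and $w_P(I):=v'_P(ID_P/QD_P)\in\mathbb Z$ is the value of the (fractional) ideal $ID_P/QD_P$ of this DVR; $\nu_I\colon X\to\mathbb Z$ is $\nu_I(P):=w_P(I)$. Continuity is with respect to the inverse topology on $X$ (subspace topology) and the discrete topology on $\mathbb Z$. *)

(* Defs.v *)
From HB Require Import structures.
From mathcomp Require Import all_boot all_order all_algebra.
From mathcomp Require Import boolp classical_sets topology.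

Set Implicit Arguments.
Unset Strict Implicit.
Unset Printing Implicit Defensive.

Import Order.TTheory GRing.Theory Num.Theory.
Local Open Scope classical_set_scope.
Local Open Scope ring_scope.

(** * Ideals and fractional ideals

    Integral ideals of [D] are sets of elements of [D]; fractional ideals, and
    the overrings [D_P], are sets of elements of the quotient field
    [{fraction D}]. *)

(* The additive subgroup generated by the products; this is the product of
   ideals (R = D), of fractional ideals, and the extension [I D_P]
   (R = {fraction D}). *)
Definition mulI (R : comNzRingType) (A B : set R) : set R :=
  [set x | exists n (a b : 'I_n -> R),
     [/\ forall i, A (a i), forall i, B (b i) & x = \sum_(i < n) a i * b i]].

Section Ideals.
Variable D : idomainType.
Local Notation K := {fraction D}.
Implicit Types (I : set D) (J : set K).

(* Unlike [idealr_closed], this allows the ideal [setT]. *)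
Definition is_ideal I : Prop :=
  [/\ I 0, forall x y, I x -> I y -> I (x + y)
    & forall a x, I x -> I (a * x)].

Definition proper_integral I : Prop := is_ideal I /\ I <> setT.

Definition gen_ideal (s : seq D) : set D :=
  [set x | exists c : 'I_(size s) -> D, x = \sum_(i < size s) c i * s`_i].

Definition fin_gen I : Prop := exists s : seq D, I = gen_ideal s.

Definition ideal_rad I : set D := [set x | exists n, I (x ^+ n)].

Definition radical_ideal I : Prop := is_ideal I /\ ideal_rad I = I.

(* [expI I 0 = D] *)
Definition expI I (n : nat) : set D := iter n (mulI I) setT.

(* An integral ideal, viewed as a fractional ideal. *)
Definition toK I : set K := @FracField.tofrac D @` I.

Definition fractional_ideal J : Prop :=
  [/\ J 0, forall x y, J x -> J y -> J (x + y)
    & forall (a : D) x, J x -> J (FracField.tofrac a * x)]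
  /\ (exists2 x, J x & x != 0)
  /\ (exists2 d : D, d != 0 &
        forall x, J x -> toK setT (FracField.tofrac d * x)).

(* Membership in Inv(D). *)
Definition invertible J : Prop :=
  fractional_ideal J /\
  exists2 J', fractional_ideal J' & mulI J J' = toK setT.

End Ideals.

Definition prufer (D : idomainType) : Prop :=
  forall I : set D, fin_gen I -> I <> [set 0] -> invertible (toK I).

(** * The prime spectrum, with the inverse topology *)

Definition Spec (D : idomainType) : Type := prime_idealr D.

HB.instance Definition _ (D : idomainType) := gen_eqMixin (Spec D).
HB.instance Definition _ (D : idomainType) := gen_choiceMixin (Spec D).

Definition carrier (D : idomainType) (P : Spec D) : set D := [set x | x \in P].

Definition VI (D : idomainType) (I : set D) : set (Spec D) :=
  [set P | I `<=` carrier P].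

(* The only topology put on [Spec D] is the inverse topology: the topology with
   subbasis of open sets the [VI I], for [I] a finitely generated ideal. *)
HB.instance Definition _ (D : idomainType) :=
  @isSubBaseTopological.Build (Spec D) (set D) (@fin_gen D) (@VI D).

(** * Localizations and their residue fields *)

Section Localization.
Variables (D : idomainType) (P : Spec D).
Local Notation K := {fraction D}.
Local Notation "x %:F" := (@FracField.tofrac D x).

(* The localization D_P, inside the quotient field. *)
Definition loc : {pred K} :=
  fun x => `[< exists a s : D, s \notin P /\ x = a%:F / s%:F >].

Let notinP_neq0 (s : D) : s \notin P -> s%:F != 0.
Proof. by apply: contraNneq => /eqP; rewrite tofrac_eq0 => /eqP ->; rewrite idealr0. Qed.

Let notinPM (s t : D) : s \notin P -> t \notin P -> s * t \notin P.
Proof. by move=> sP tP; rewrite prime_idealrM negb_or sP. Qed.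

Lemma loc_subring_closed : subring_closed loc.
Proof.
split.
- by apply/asboolP; exists 1, 1; rewrite idealr1 tofrac1 divr1.
- move=> x y /asboolP[a [s [sP ->]]] /asboolP[b [t [tP ->]]].
  apply/asboolP; exists (a * t - b * s), (s * t); split; first exact: notinPM.
  rewrite -mulNr addf_div ?notinP_neq0// rmorphB !rmorphM/=.
  by rewrite mulNr.
- move=> x y /asboolP[a [s [sP ->]]] /asboolP[b [t [tP ->]]].
  apply/asboolP; exists (a * b), (s * t); split; first exact: notinPM.
  by rewrite mulf_div !rmorphM.
Qed.

HB.instance Definition _ := GRing.isSubringClosed.Build K loc loc_subring_closed.

(* D_P as a ring. *)
Definition locT : Type := {x : K | x \in loc}.
HB.instance Definition _ := SubChoice.on locT.
HB.instance Definition _ := [SubChoice_isSubComNzRing of locT by <:].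

(* The maximal ideal P D_P. *)
Definition locM : {pred locT} :=
  fun x => `[< exists a s : D, [/\ a \in P, s \notin P & val x = a%:F / s%:F] >].

Lemma locM_idealr_closed : idealr_closed locM.
Proof.
split.
- by apply/asboolP; exists 0, 1; rewrite idealr0 idealr1 tofrac0 mul0r.
- apply/negP => /asboolP[a [s [aP sP]]].
  rewrite /= => /esym/(canRL (divfK (notinP_neq0 sP))).
  rewrite mul1r => /eqP; rewrite tofrac_eq => /eqP as_.
  by rewrite -as_ aP in sP.
- move=> x u v /asboolP[a [s [aP sP us]]] /asboolP[b [t [bP tP vt]]].
  have /asboolP[c [r [rP xr]]] := valP x.
  apply/asboolP; exists (c * a * t + b * (r * s)), (r * s * t); split.
  + by rewrite rpredD// ?[_ * t]mulrC ?[b * _]mulrC !idealMr.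
  + by rewrite !notinPM.
  + rewrite rmorphD rmorphM/= us vt xr mulf_div addf_div ?mulf_neq0 ?notinP_neq0//.
    by rewrite rmorphD/= !rmorphM.
Qed.

HB.instance Definition _ := isIdealr.Build locT locM locM_idealr_closed.

(* The residue field D_P / P D_P. *)
Definition resf : Type := {ideal_quot locM}.
HB.instance Definition _ := GRing.ComNzRing.on resf.

Definition to_resf (x : locT) : resf := \pi_({ideal_quot locM})%qT x.

Let resf_inv (x : resf) : resf :=
  if x == 0 then 0 else xget 0 [set y | y * x = 1].

Let resf_mulVx (x : resf) : x != 0 -> resf_inv x * x = 1.
Proof.
move=> x0; rewrite /resf_inv (negbTE x0).
suff [y yx] : exists y, y * x = 1 by case: xgetP => [z _ //|/(_ y)].
have [u xu] : exists u, x = to_resf u by exists (repr x); rewrite /to_resf reprK.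
have uM : u \notin locM.
  apply: contra x0 => uM; rewrite xu /to_resf.
  by rewrite -[0](rmorph0 (\pi_({ideal_quot locM}))%qT) -Quotient.idealrBE subr0.
have /asboolP[a [s [sP us]]] := valP u.
have aP : a \notin P by apply: contra uM => aP; apply/asboolP; exists a, s.
have wP : s%:F / a%:F \in loc by apply/asboolP; exists s, a.
exists (to_resf (exist (fun z : K => z \in loc) _ wP)).
rewrite xu /to_resf -rmorphM -[RHS](rmorph1 (\pi_({ideal_quot locM}))%qT).
congr (\pi_({ideal_quot locM}) _)%qT; apply: val_inj => /=.
by rewrite us mulf_div [X in _ / X]mulrC divff// mulf_neq0// notinP_neq0.
Qed.

Let resf_inv0 : resf_inv 0 = 0. Proof. by rewrite /resf_inv eqxx. Qed.

HB.instance Definition _ :=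
  GRing.ComNzRing_isField.Build resf resf_mulVx resf_inv0.

End Localization.

Definition setloc (D : idomainType) (P : Spec D) : set {fraction D} :=
  [set x | x \in loc P].

(** * Discrete valuations *)

(* [v] is the normalized discrete valuation of [F] with valuation ring [V].
   A valuation is a function on the nonzero elements; [v 0] is irrelevant. *)
Definition normalized_valuation (F : fieldType) (V : set F) (v : F -> int) :
    Prop :=
  [/\ forall x y, x != 0 -> y != 0 -> v (x * y) = v x + v y,
      forall x y, x != 0 -> y != 0 -> x + y != 0 ->
        Num.min (v x) (v y) <= v (x + y),
      exists2 x, x != 0 & v x = 1
    & V = [set x | x = 0 \/ 0 <= v x]].

(* [n] is the value of the fractional ideal [J], i.e. the minimum of [v] on
   the nonzero elements of [J]. *)
Definition ideal_value (F : fieldType) (v : F -> int) (J : set F) (n : int) :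
    Prop :=
  (exists x, [/\ J x, x != 0 & v x = n]) /\
  (forall x, J x -> x != 0 -> n <= v x).

(** * Splitting sets, critical ideals, ideal functions *)

Section SplittingSets.
Variable D : idomainType.
Local Notation K := {fraction D}.
Implicit Types (I : set D) (J : set K) (X : set (Spec D)) (P Q M : Spec D).

Definition Max : set (Spec D) :=
  [set M | forall I, is_ideal I -> carrier M `<=` I -> I = carrier M \/ I = setT].

Definition up X : set (Spec D) :=
  [set P | exists2 Q, X Q & carrier Q `<=` carrier P].

Definition splitting_set X : Prop := X = up X /\ open X.

Definition discrete_spec X : Prop :=
  forall P, X P -> carrier P <> mulI (carrier P) (carrier P).

Definition supp J : set (Spec D) :=
  [set P | mulI J (setloc P) <> setloc P].

Definition Inv_ X J : Prop := invertible J /\ supp J `<=` X.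

Definition Crit X : set (Spec D) :=
  [set M | [/\ Max M, X M &
    ~ exists I, [/\ radical_ideal I, Inv_ X (toK I) & I `<=` carrier M]]].

(* The image in the residue field D_Q / Q D_Q of a subset of the quotient
   field.  When [Q D_P = Q D_Q], it is [D_P / Q D_P] for [A = D_P], and
   [J D_P / Q D_P] for [A = J D_P]. *)
Definition modQ Q (A : set K) : set (resf Q) :=
  [set y | exists2 x : locT Q, A (val x) & y = to_resf x].
Arguments modQ : clear implicits.

(* [n] is [w_P(J)]: for the prime [Q], intersection of the [P ^ n] (n >= 1),
   and the normalized valuation [v] of the DVR [D_P / Q D_P] of quotient field
   [D_Q / Q D_Q], [n] is the value of [J D_P / Q D_P]. *)
Definition is_w P J (n : int) : Prop :=
  exists (Q : Spec D) (v : resf Q -> int),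
    [/\ carrier Q = \bigcap_k expI (carrier P) k.+1,
        normalized_valuation (modQ Q (setloc P)) v
      & ideal_value v (modQ Q (mulI J (setloc P))) n].

(* [w_P(J)] exists and is unique for [P \in X] and [J \in Inv_X(D)], with [D]
   Pruefer and [X] discrete, splitting and contained in [Max(D)]; outside that
   case the value 0 of [nu J P] is a placeholder. *)
Definition nu J : Spec D -> discrete_topology int :=
  fun P => xget 0 [set n : int | is_w P J n].

End SplittingSets.

Arguments Max : clear implicits.

(* Main.v *)
Require Import Defs.
From HB Require Import structures.
From mathcomp Require Import all_boot all_order all_algebra finmap.
From mathcomp Require Import boolp classical_sets topology.

(** The set [X] consists of maximal ideals, so an ideal [I] of [Inv_X(D)] is
    contained only in maximal ideals. Hence, at each [P] of [X] containing it, its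
    radical is locally the maximal ideal [P D_P] ([local_rad]). Moreover [D_P] is
    a valuation ring ([local_total]) and [P D_P] is generated by any [p] of [P]
    outside [P ^ 2] ([unif_dvd]), so [I D_P] is a power of [P D_P]. All conditions
    are read off the exponent [has_ord P I n] of this power: [I] is locally
    radical exactly when its exponents are at most one.

    The ideal function computes this exponent. With [Q] the intersection of the
    powers of [P], the elements of [D_Q] outside [Q D_Q] are the [u * p ^ k] with
    [u] a unit of [D_P] and [k] an integer, and [k] defines a normalized valuation
    on the residue field at [Q] ([res_val_normalized]). It is the only one with
    ring [D_P / Q D_P] ([normalized_valuation_uniq]). A fractional ideal of
    [Inv_X(D)] is a quotient [A / B] of integral ones ([Inv_quot]), and its value
    is the difference of the exponents of [A] and [B] ([nu_quot]).

    The conditions are then linked in a cycle. If no maximal ideal is critical,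
    the radical of [I] is finitely generated locally, since near a maximal ideal
    [M] it is given by [I] and a radical ideal of [Inv_X(D)] inside [M]
    ([no_crit_rad_fin_gen]). If radicals are finitely generated, they are
    invertible; dividing [I] by its radical lowers all positive exponents by one,
    and the exponents are bounded ([ord_bounded]), so repeated division factors
    [I] ([rad_fin_gen_factor]). If [I] is a product of finitely generated radical
    ideals, its exponent at [P] is the number of factors inside [P], and each
    factor contributes a locally constant function ([loc_cst_radical]), which
    gives continuity ([factor_nu_continuous]). Finally, an ideal of [Inv_X(D)]
    inside [M] can be enlarged to have exponent one at [M]; by continuity it has
    exponent one near [M], and a further enlargement removes the other primes and
    leaves a radical ideal inside [M] ([nu_continuous_no_crit]). *)

Set Implicit Arguments.
Unset Strict Implicit.
Unset Printing Implicit Defensive.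

Import Order.TTheory GRing.Theory Num.Theory.
Local Open Scope classical_set_scope.
Local Open Scope ring_scope.

(** * Products of ideals *)

Section MulI.
Variable R : comNzRingType.
Implicit Types A B C E F G : set R.

Lemma mulI_mem A B a b : A a -> B b -> mulI A B (a * b).
Proof.
by move=> Aa Bb; exists 1%N, (fun=> a), (fun=> b); rewrite big_ord1.
Qed.

Lemma sum_closed C n (F : 'I_n -> R) : C 0 ->
  (forall x y, C x -> C y -> C (x + y)) -> (forall i, C (F i)) -> C (\sum_i F i).
Proof. by move=> C0 CD CF; apply: (big_ind C). Qed.

Lemma mulI_sub A B C : C 0 -> (forall x y, C x -> C y -> C (x + y)) ->
  (forall a b, A a -> B b -> C (a * b)) -> mulI A B `<=` C.
Proof.
by move=> C0 CD CM _ [n [a [b [Aa Bb ->]]]]; apply: sum_closed => // i; apply: CM.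
Qed.

Lemma mulI0 A B : mulI A B 0.
Proof. by exists 0%N, (fun=> 0), (fun=> 0); split; [case|case|rewrite big_ord0]. Qed.

Lemma mulID A B x y : mulI A B x -> mulI A B y -> mulI A B (x + y).
Proof.
move=> [n [a [b [Aa Bb ->]]]] [m [c [d [Ac Bd ->]]]].
pose glue (f : 'I_n -> R) (g : 'I_m -> R) (i : 'I_(n + m)) :=
  match split i with inl j => f j | inr j => g j end.
exists (n + m)%N, (glue a c), (glue b d); split.
- by move=> i; rewrite /glue; case: split.
- by move=> i; rewrite /glue; case: split.
rewrite big_split_ord /glue; congr (_ + _); apply: eq_bigr => i _.
  by rewrite -[lshift m i]/(unsplit (inl i)) unsplitK.
by rewrite -[rshift n i]/(unsplit (inr i)) unsplitK.
Qed.

Lemma mulIC A B : mulI A B = mulI B A.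
Proof.
suff sub C E : mulI C E `<=` mulI E C by apply/seteqP; split; apply: sub.
apply: mulI_sub; [exact: mulI0|exact: mulID|move=> a b Ca Eb].
by rewrite mulrC; apply: mulI_mem.
Qed.

Lemma mulIA A B C : mulI A (mulI B C) = mulI (mulI A B) C.
Proof.
have sub E F G : mulI E (mulI F G) `<=` mulI (mulI E F) G.
  apply: mulI_sub; [exact: mulI0|exact: mulID|move=> e _ Ee [n [f [g [Ff Gg ->]]]]].
  rewrite mulr_sumr; apply: sum_closed; [exact: mulI0|exact: mulID|move=> i].
  by rewrite mulrA; apply: mulI_mem => //; apply: mulI_mem.
apply/seteqP; split; first exact: sub.
by rewrite (mulIC A B) (mulIC (mulI B A) C) (mulIC B C) (mulIC A (mulI C B)); apply: sub.
Qed.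

Lemma mulIS A B C E : A `<=` C -> B `<=` E -> mulI A B `<=` mulI C E.
Proof.
move=> AC BE; apply: mulI_sub; [exact: mulI0|exact: mulID|move=> a b Aa Bb].
by apply: mulI_mem; [apply: AC|apply: BE].
Qed.

Lemma mulI_scale A B c : (forall a, A a -> A (c * a)) ->
  forall x, mulI A B x -> mulI A B (c * x).
Proof.
move=> Ac _ [n [a [b [Aa Bb ->]]]]; rewrite mulr_sumr.
exists n, (fun i => c * a i), b; split=> // [i|]; first exact: Ac.
by apply: eq_bigr => i _; rewrite mulrA.
Qed.

End MulI.

(** * Integral ideals *)

Section Ideals.
Variable D : idomainType.
Implicit Types (A B I J : set D) (d x y : D) (s t : seq D).

Definition addI A B : set D := [set x | exists a b, [/\ A a, B b & x = a + b]].

Definition prin d : set D := [set x | exists c, x = d * c].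

(** The residual, or colon ideal, [(I : J)]. *)
Definition colon I J : set D := [set x | forall y, J y -> I (y * x)].

Lemma is_ideal0 I : is_ideal I -> I 0. Proof. by case. Qed.
Lemma is_idealD I x y : is_ideal I -> I x -> I y -> I (x + y).
Proof. by case=> _ + _; apply. Qed.
Lemma is_idealMl I a x : is_ideal I -> I x -> I (a * x).
Proof. by case=> _ _; apply. Qed.
Lemma is_idealMr I a x : is_ideal I -> I x -> I (x * a).
Proof. by rewrite mulrC; apply: is_idealMl. Qed.

Lemma ideal_sum I n (F : 'I_n -> D) :
  is_ideal I -> (forall i, I (F i)) -> I (\sum_i F i).
Proof. by case=> I0 ID _; apply: sum_closed. Qed.

Lemma is_ideal1 I : is_ideal I -> I 1 -> I = setT.
Proof.
move=> iI I1; apply/seteqP; split=> // x _.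
by rewrite -[x]mulr1; apply: is_idealMl.
Qed.

Lemma setT_ideal : is_ideal (@setT D). Proof. by []. Qed.

Lemma prin_ideal d : is_ideal (prin d).
Proof.
split; first by exists 0; rewrite mulr0.
  by move=> _ _ [c ->] [e ->]; exists (c + e); rewrite mulrDr.
by move=> a _ [c ->]; exists (a * c); rewrite mulrCA.
Qed.

Lemma prin_mem d : prin d d. Proof. by exists 1; rewrite mulr1. Qed.

Lemma addI_ideal A B : is_ideal A -> is_ideal B -> is_ideal (addI A B).
Proof.
move=> iA iB; split; first by exists 0, 0; rewrite addr0; split=> //; apply: is_ideal0.
  move=> _ _ [a [b [Aa Bb ->]]] [c [d [Ac Bd ->]]].
  by exists (a + c), (b + d); rewrite addrACA; split=> //; apply: is_idealD.
move=> c _ [a [b [Aa Bb ->]]].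
by exists (c * a), (c * b); rewrite mulrDr; split=> //; apply: is_idealMl.
Qed.

Lemma addI_subl A B : is_ideal B -> A `<=` addI A B.
Proof. by move=> iB a Aa; exists a, 0; rewrite addr0; split=> //; apply: is_ideal0. Qed.

Lemma addI_subr A B : is_ideal A -> B `<=` addI A B.
Proof. by move=> iA b Bb; exists 0, b; rewrite add0r; split=> //; apply: is_ideal0. Qed.

Lemma addI_sub A B J : is_ideal J -> A `<=` J -> B `<=` J -> addI A B `<=` J.
Proof. by move=> iJ AJ BJ _ [a [b [/AJ Ja /BJ Jb ->]]]; apply: is_idealD. Qed.

Lemma mulI_ideal A B : is_ideal A -> is_ideal (mulI A B).
Proof.
move=> iA; split; [exact: mulI0|exact: mulID|move=> a x].
by apply: mulI_scale => b; apply: is_idealMl.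
Qed.

Lemma mulI_subl A B : is_ideal A -> mulI A B `<=` A.
Proof.
by case=> A0 AD AM; apply: mulI_sub => // a b Aa _; rewrite mulrC; apply: AM.
Qed.

Lemma mulTI A : is_ideal A -> mulI setT A = A.
Proof.
move=> iA; apply/seteqP; split; first by rewrite mulIC; apply: mulI_subl.
by move=> a Aa; rewrite -[a]mul1r; apply: mulI_mem.
Qed.

Lemma colon_ideal I J : is_ideal I -> is_ideal (colon I J).
Proof.
move=> iI; split; first by move=> y _; rewrite mulr0; apply: is_ideal0.
  by move=> x y Ix Iy z Jz; rewrite mulrDr; apply: is_idealD; [|apply: Ix|apply: Iy].
by move=> a x Ix y Jy; rewrite mulrCA; apply: is_idealMl => //; apply: Ix.
Qed.

Lemma sub_colon I J : is_ideal I -> I `<=` colon I J.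
Proof. by move=> iI x Ix y _; apply: is_idealMl. Qed.

Lemma expI_ideal I n : is_ideal I -> is_ideal (expI I n).
Proof. by move=> iI; case: n => [|n] //; apply: mulI_ideal. Qed.

Lemma expI1 I : is_ideal I -> expI I 1 = I.
Proof. by move=> iI; rewrite /expI /= mulIC mulTI. Qed.

Lemma expID I n m : is_ideal I -> expI I (n + m) = mulI (expI I n) (expI I m).
Proof.
move=> iI; elim: n => [|n IH]; first by rewrite mulTI//; apply: expI_ideal.
by rewrite addSn /expI !iterS -mulIA; congr mulI.
Qed.

Lemma expI_exp I x n : I x -> expI I n (x ^+ n).
Proof. by move=> Ix; elim: n => // n IH; rewrite exprS; apply: mulI_mem. Qed.

(** ** Radicals *)

Lemma sub_rad I : I `<=` ideal_rad I.
Proof. by move=> x Ix; exists 1%N; rewrite expr1. Qed.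

Lemma rad_ideal I : is_ideal I -> is_ideal (ideal_rad I).
Proof.
move=> iI; split.
- by exists 1%N; rewrite expr1; apply: is_ideal0.
- move=> x y [n Ixn] [m Iym]; exists (n + m)%N; rewrite exprDn.
  apply: ideal_sum => // i; rewrite -mulr_natr; apply: is_idealMr => //.
  have [im|mi] := leqP m i.
    by rewrite -(subnK im) exprD; apply: is_idealMl => //; apply: is_idealMl.
  have le : (n <= n + m - i)%N by rewrite -addnBA ?leq_addr// ltnW.
  by rewrite -(subnK le) exprD mulrAC; apply: is_idealMl.
- by move=> a x [n Ixn]; exists n; rewrite exprMn; apply: is_idealMl.
Qed.

Lemma rad_rad I : ideal_rad (ideal_rad I) = ideal_rad I.
Proof.
apply/seteqP; split; last exact: sub_rad.
by move=> x [n [m]]; rewrite -exprM => ?; exists (n * m)%N.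
Qed.

Lemma radical_rad I : is_ideal I -> radical_ideal (ideal_rad I).
Proof. by move=> iI; split; [apply: rad_ideal|apply: rad_rad]. Qed.

(** ** Finitely generated ideals *)

Lemma gen_ideal_ideal s : is_ideal (gen_ideal s).
Proof.
split; first by exists (fun=> 0); rewrite big1// => i _; rewrite mul0r.
  move=> _ _ [c ->] [d ->]; exists (fun i => c i + d i).
  by rewrite -big_split; apply: eq_bigr => i _; rewrite mulrDl.
move=> a _ [c ->]; exists (fun i => a * c i); rewrite mulr_sumr.
by apply: eq_bigr => i _; rewrite mulrA.
Qed.

Lemma mem_gen s x : x \in s -> gen_ideal s x.
Proof.
move=> xs; exists (fun i => (nat_of_ord i == index x s)%:R).
have lt : (index x s < size s)%N by rewrite index_mem.
rewrite (bigD1 (Ordinal lt))//= eqxx mul1r nth_index// big1 ?addr0// => i.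
by move=> /negbTE; rewrite -val_eqE /= => ->; rewrite mul0r.
Qed.

Lemma gen_sub s J : is_ideal J -> {in s, forall x, J x} -> gen_ideal s `<=` J.
Proof.
move=> iJ sJ _ [c ->]; apply: ideal_sum => // i.
by apply: is_idealMl => //; apply: sJ; apply: mem_nth.
Qed.

Lemma gen_cat s t : gen_ideal (s ++ t) = addI (gen_ideal s) (gen_ideal t).
Proof.
have is_ := gen_ideal_ideal s; have it := gen_ideal_ideal t.
apply/seteqP; split.
  apply: gen_sub; first exact: addI_ideal.
  move=> x; rewrite mem_cat => /orP[] xs; first by apply: addI_subl => //; apply: mem_gen.
  by apply: addI_subr => //; apply: mem_gen.
apply: addI_sub; first exact: gen_ideal_ideal.
  by apply: gen_sub => [|x xs]; [exact: gen_ideal_ideal|apply: mem_gen; rewrite mem_cat xs].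
by apply: gen_sub => [|x xs]; [exact: gen_ideal_ideal|apply: mem_gen; rewrite mem_cat xs orbT].
Qed.

Lemma gen_nil : gen_ideal [::] = [set 0] :> set D.
Proof.
apply/seteqP; split; first by move=> _ [c ->]; rewrite big_ord0.
by move=> _ ->; apply: is_ideal0; apply: gen_ideal_ideal.
Qed.

Lemma prinE d : prin d = gen_ideal [:: d].
Proof.
apply/seteqP; split; last first.
  by apply: gen_sub; [exact: prin_ideal|move=> x /[!inE] /eqP ->; apply: prin_mem].
move=> _ [c ->]; apply: is_idealMr; first exact: gen_ideal_ideal.
by apply: mem_gen; rewrite inE.
Qed.

Lemma fin_gen_ideal I : fin_gen I -> is_ideal I.
Proof. by move=> [s ->]; apply: gen_ideal_ideal. Qed.

Lemma fin_gen_prin d : fin_gen (prin d).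
Proof. by exists [:: d]; rewrite prinE. Qed.

Lemma fin_gen_add A B : fin_gen A -> fin_gen B -> fin_gen (addI A B).
Proof. by move=> [s ->] [t ->]; exists (s ++ t); rewrite gen_cat. Qed.

(** ** Invertible integral ideals *)

(** Invertibility expressed without leaving [D]: some multiple of the ideal is
    principal and nonzero. *)
Definition inv_ideal A : Prop :=
  exists B d, [/\ is_ideal B, d != 0 & mulI A B = prin d].

Lemma inv_ideal_neq0 A : inv_ideal A -> exists2 a, A a & a != 0.
Proof.
move=> [B [d [iB d0 AB]]]; apply: contrapT => nA.
have : mulI A B `<=` [set 0].
  apply: mulI_sub => // [x y -> ->|a b Aa _]; first by rewrite /= addr0.
  have [->|a0] := eqVneq a 0; first by rewrite /= mul0r.
  by case: nA; exists a.
by rewrite AB => /(_ _ (prin_mem d)) /= /eqP; rewrite (negbTE d0).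
Qed.

(** If [d = \sum_i a_i b_i] generates [A * B], then every [x] of [A] is
    [\sum_i a_i (x b_i / d)]. *)
Lemma inv_ideal_fin_gen A : is_ideal A -> inv_ideal A -> fin_gen A.
Proof.
move=> iA [B [d [iB d0 AB]]].
have [n [a [b [Aa Bb dE]]]] : mulI A B d by rewrite AB; apply: prin_mem.
exists [seq a i | i <- enum 'I_n]; apply/seteqP; split; last first.
  by apply: gen_sub => // x /mapP[i _ ->].
move=> x Ax; have /choice[c xc] : forall i, exists c, x * b i = d * c.
  by move=> i; have := mulI_mem Ax (Bb i); rewrite AB.
have -> : x = \sum_i a i * c i.
  apply: (mulfI d0); rewrite mulr_sumr {1}dE mulr_suml; apply: eq_bigr => i _.
  by rewrite mulrAC -mulrA xc mulrCA.
have ig := gen_ideal_ideal [seq a i | i <- enum 'I_n].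
apply: ideal_sum => // i; apply: is_idealMr => //.
by apply: mem_gen; apply: map_f; rewrite mem_enum.
Qed.

(** To contain is to divide, for invertible ideals: in the combination
    [x = \sum_i r_i (x b_i / d)] as above, the coefficients multiply [R] into
    the multiples of [x], hence into [I]. *)
Lemma inv_ideal_dvd R I : inv_ideal R -> is_ideal I -> I `<=` R ->
  mulI R (colon I R) = I.
Proof.
move=> [B [d [iB d0 RB]]] iI IR; apply/seteqP; split.
  by apply: mulI_sub; [exact: is_ideal0|move=> x y; apply: is_idealD|move=> a b Ra; apply].
have [n [r [b [Rr Bb dE]]]] : mulI R B d by rewrite RB; apply: prin_mem.
move=> x Ix; have /choice[c xc] : forall i, exists c, x * b i = d * c.
  by move=> i; have := mulI_mem (IR _ Ix) (Bb i); rewrite RB.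
have -> : x = \sum_i r i * c i.
  apply: (mulfI d0); rewrite mulr_sumr {1}dE mulr_suml; apply: eq_bigr => i _.
  by rewrite mulrAC -mulrA xc mulrCA.
apply: sum_closed; [exact: mulI0|exact: mulID|move=> i].
apply: mulI_mem => // y Ry.
have [e ye] : exists e, y * b i = d * e by have := mulI_mem Ry (Bb i); rewrite RB.
suff -> : y * c i = x * e by apply: is_idealMr.
by apply: (mulfI d0); rewrite mulrCA -xc [RHS]mulrCA -ye mulrCA.
Qed.

Lemma inv_ideal_factor R A : is_ideal R -> inv_ideal (mulI R A) -> inv_ideal A.
Proof.
move=> iR [B [d [iB d0 RAB]]]; exists (mulI R B), d; split=> //.
  exact: mulI_ideal.
by rewrite mulIA [mulI A R]mulIC.
Qed.

Lemma inv_ideal_prin d : d != 0 -> inv_ideal (prin d).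
Proof.
move=> d0; exists setT, d; split=> //.
by rewrite mulIC mulTI//; apply: prin_ideal.
Qed.

End Ideals.

(** * Prime ideals *)

Section Primes.
Variable D : idomainType.
Implicit Types (A B I J : set D) (P Q M : Spec D) (x y : D) (X : set (Spec D)).

Lemma carrier_ideal P : is_ideal (carrier P).
Proof.
split; first exact: idealr0.
  by move=> x y; rewrite /carrier /= => xP yP; rewrite rpredD.
by move=> a x; rewrite /carrier /= => xP; apply: idealMr.
Qed.

Lemma carrier1 P : ~ carrier P 1.
Proof. by rewrite /carrier /= idealr1. Qed.

Lemma carrierM P x y : ~ carrier P x -> ~ carrier P y -> ~ carrier P (x * y).
Proof. by rewrite /carrier /= prime_idealrM => xP yP /orP[]. Qed.

Lemma carrierX P x n : carrier P (x ^+ n) -> carrier P x.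
Proof.
elim: n => [/carrier1//|n IH]; rewrite exprS => xn; apply: contrapT => xP.
by apply: (carrierM xP) xn => /IH.
Qed.

Lemma Spec_of (S : set D) : is_ideal S -> ~ S 1 ->
  (forall x y, S (x * y) -> S x \/ S y) -> exists P, carrier P = S.
Proof.
move=> [S0 SD SM] S1 Sp; pose p : {pred D} := fun x => `[< S x >].
have pid : idealr_closed p.
  split; first by apply/asboolP.
    by apply/asboolP.
  move=> a x y /asboolP Sx /asboolP Sy; apply/asboolP.
  by apply: SD => //; apply: SM.
have pp : prime_idealr_closed p.
  move=> x y /asboolP /Sp[] ?; apply/orP; [left|right]; exact/asboolP.
pose Id := isIdealr.Build D p pid.
pose Pr := isPrimeIdealrClosed.Build D p pp.
pose P : Spec D := HB.pack_for (prime_idealr D) p Id Pr.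
by exists P; apply/seteqP; split=> x; rewrite /carrier /= => /asboolP.
Qed.

Lemma Spec_inj P Q : carrier P = carrier Q -> P = Q.
Proof.
case: P Q => [p cp] [q cq] pq.
have {}pq : p = q.
  apply/funext => x; apply/idP/idP.
    by move: (congr1 (fun S => S x) pq); rewrite /carrier /= => E px; have : x \in q by rewrite -E.
  by move: (congr1 (fun S => S x) pq); rewrite /carrier /= => E px; have : x \in p by rewrite E.
move: cp cq; rewrite pq => cp cq; congr PrimeIdealr.Pack.
case: cp cq => [[a] [b] [c] [d]] [[a'] [b'] [c'] [d']].
by rewrite (Prop_irrelevance a a') (Prop_irrelevance b b') (Prop_irrelevance c c')
           (Prop_irrelevance d d').
Qed.

(** An ideal [A] maximal among those containing [I] and missing [S] is prime: if
    neither [x] nor [y] is in [A], then [A + (x)] and [A + (y)] meet [S], and so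
    does their product, which lies in [A + (x y)]. *)
Lemma prime_avoidance I (S : set D) : is_ideal I -> S 1 ->
  (forall x y, S x -> S y -> S (x * y)) -> (forall x, I x -> ~ S x) ->
  exists P, I `<=` carrier P /\ forall x, carrier P x -> ~ S x.
Proof.
move=> iI S1 SM IS.
(* The empty set is admitted because it is the union of the empty chain. *)
pose Pr (A : set D) := A = set0 \/ [/\ is_ideal A, I `<=` A & forall x, A x -> ~ S x].
have [|A [PA maxA]] := @Zorn_bigcup _ Pr.
  move=> F FPr totF; have [[B FB B0]|nF] := pselect (exists2 B, F B & B <> set0); last first.
    left; apply/seteqP; split=> // x [B FB Bx].
    by case: nF; exists B => // B0; rewrite B0 in Bx.
  have {B0} [iB IB _] : [/\ is_ideal B, I `<=` B & forall x, B x -> ~ S x].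
    by case: (FPr _ FB).
  have FE C x : F C -> C x -> [/\ is_ideal C, I `<=` C & forall x, C x -> ~ S x].
    by move=> /FPr[-> //|].
  right; split.
  - split; first by exists B => //; apply: is_ideal0.
      move=> x y [C FC Cx] [E FE' Ey].
      have [iC _ _] := FE _ _ FC Cx; have [iE _ _] := FE _ _ FE' Ey.
      by have [CE|EC] := totF _ _ FC FE'; [exists E|exists C] => //;
        apply: is_idealD => //; [apply: CE|apply: EC].
    move=> a x [C FC Cx]; exists C => //.
    by have [iC _ _] := FE _ _ FC Cx; apply: is_idealMl.
  - by move=> x Ix; exists B => //; apply: IB.
  - by move=> x [C FC Cx]; have [_ _] := FE _ _ FC Cx; apply.
have {PA} [iA IA AS] : [/\ is_ideal A, I `<=` A & forall x, A x -> ~ S x].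
  case: PA => // A0; have AI : A `<` I.
    by rewrite A0; split=> [//|I0]; exact: (I0 0 (is_ideal0 iI)).
  by exfalso; apply: (maxA I AI); right; split.
have big x : ~ A x -> exists a c, A a /\ S (a + c * x).
  move=> nAx; apply: contrapT => nS.
  have AAx : A `<` addI A (prin x).
    split; first by apply: addI_subl; apply: prin_ideal.
    by move=> /(_ x) H; apply: nAx; apply: H; apply: addI_subr => //; apply: prin_mem.
  apply: (maxA _ AAx); right; split.
  - by apply: addI_ideal => //; apply: prin_ideal.
  - by apply: subset_trans IA _; apply: addI_subl; apply: prin_ideal.
  - move=> _ [a [_ [Aa [c ->] ->]]] Sx; apply: nS.
    by exists a, c; rewrite mulrC.
have [|x y Axy|P PA] := @Spec_of A iA; last by exists P; rewrite PA.
  by move=> /AS.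
apply: contrapT => /not_orP[/big[a [c [Aa Sx]]] /big[b [e [Ab Sy]]]].
apply: (AS _ _ (SM _ _ Sx Sy)).
rewrite mulrDl; apply: is_idealD => //; first exact: is_idealMr.
rewrite mulrDr; apply: is_idealD => //; first exact: is_idealMl.
by rewrite mulrACA; apply: is_idealMl.
Qed.

Lemma exists_prime I : is_ideal I -> I <> setT -> exists P, I `<=` carrier P.
Proof.
move=> iI IT; have [//|_ _ -> ->|x Ix x1|P [IP _]] := @prime_avoidance I [set 1] iI.
- by rewrite /= mulr1.
- by apply: IT; apply: is_ideal1 => //; rewrite -x1.
- by exists P.
Qed.

(** The [s] such that [I] contains [s * x] form an ideal containing [I]; if it
    were proper, a prime would contain it. *)
Lemma ideal_local I x : is_ideal I ->
  (forall P, I `<=` carrier P -> exists2 s, ~ carrier P s & I (s * x)) -> I x.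
Proof.
move=> iI loc_; have iC : is_ideal (colon I [set x]) by apply: colon_ideal.
have [C1|nC] := pselect (colon I [set x] = setT).
  have : colon I [set x] 1 by rewrite C1.
  by move=> /(_ x erefl); rewrite mulr1.
have [P CP] := exists_prime iC nC.
have [|s sP Isx] := loc_ P; first by apply: subset_trans CP; apply: sub_colon.
by case: sP; apply: CP => _ ->; rewrite mulrC.
Qed.

(** The product of the denominators found for the generators serves for all of
    [I]. *)
Lemma fin_gen_local P I (C : set D) : fin_gen I -> is_ideal C ->
  (forall x, I x -> exists2 s, ~ carrier P s & C (s * x)) ->
  exists2 s, ~ carrier P s & forall x, I x -> C (s * x).
Proof.
move=> [g ->] iC H.
have [s sP Hs] : exists2 s, ~ carrier P s & {in g, forall x, C (s * x)}.
  have {H} : {in g, forall x, exists2 s, ~ carrier P s & C (s * x)}.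
    by move=> x xg; apply: H; apply: mem_gen.
  elim: g => [_|x g IH H]; first by exists 1 => //; apply: carrier1.
  have [t tP Ct] : exists2 t, ~ carrier P t & {in g, forall x, C (t * x)}.
    by apply: IH => y yg; apply: H; rewrite inE yg orbT.
  have [s sP Cs] := H x (mem_head _ _).
  exists (s * t); first exact: carrierM.
  move=> y; rewrite inE => /orP[/eqP ->|/Ct Cy].
    by rewrite mulrAC; apply: is_idealMr.
  by rewrite -mulrA; apply: is_idealMl.
exists s => //.
suff sub : gen_ideal g `<=` [set x | C (x * s)] by move=> x /sub; rewrite /= mulrC.
apply: gen_sub; last by move=> x xg; rewrite /= mulrC; apply: Hs.
split; first by rewrite /= mul0r; apply: is_ideal0.
  by move=> x y; rewrite /= mulrDl; apply: is_idealD.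
by move=> a x; rewrite /= -mulrA; apply: is_idealMl.
Qed.

(** ** Maximal ideals *)

Lemma Max_coprime P s : Max D P -> ~ carrier P s ->
  exists c p, carrier P p /\ 1 = s * c + p.
Proof.
move=> mP sP; have iP := carrier_ideal P.
have [||E|E] := mP (addI (prin s) (carrier P)).
- by apply: addI_ideal => //; apply: prin_ideal.
- by apply: addI_subr; apply: prin_ideal.
- by case: sP; rewrite -E; apply: addI_subl => //; apply: prin_mem.
- have : addI (prin s) (carrier P) 1 by rewrite E.
  by move=> [_ [p [[c ->] Pp ->]]]; exists c, p.
Qed.

Lemma Max_sub P Q : Max D P -> carrier P `<=` carrier Q -> P = Q.
Proof.
move=> mP PQ; apply: Spec_inj; have [|//|QT] := mP _ _ PQ; first exact: carrier_ideal.
by case: (@carrier1 Q); rewrite QT.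
Qed.

(** An element [s] outside [P] is invertible modulo [P ^ n]: if [1 - p] is a
    multiple of [s], so is [1 - p ^ n]. *)
Lemma expI_primary P s x n : Max D P -> ~ carrier P s ->
  expI (carrier P) n (s * x) -> expI (carrier P) n x.
Proof.
move=> mP sP sx; have [c [p [Pp E]]] := Max_coprime mP sP.
have iP := expI_ideal n (carrier_ideal P).
have -> : x = (1 - p ^+ n) * x + p ^+ n * x by rewrite -mulrDl subrK mul1r.
apply: is_idealD => //; last by apply: is_idealMr => //; apply: expI_exp.
have E1 : 1 - p = s * c by rewrite E addrK.
rewrite -{1}(expr1n D n) subrXX E1 mulrAC (mulrAC s).
by apply: is_idealMr => //; apply: is_idealMr.
Qed.

(** If only maximal ideals contain [I], then [I] becomes primary to the maximal
    ideal after localizing at any of them: a prime missing all [s * x ^+ n]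
    would contain [I] and lie strictly below [P]. *)
Lemma local_rad X I P x : X `<=` Max D -> is_ideal I -> VI I `<=` X ->
  I `<=` carrier P -> carrier P x ->
  exists2 s, ~ carrier P s & ideal_rad I (s * x).
Proof.
move=> XM iI IX IP Px.
pose S := [set y | exists s n, ~ carrier P s /\ y = s * x ^+ n].
have [[y [Iy [s [n [sP yE]]]]]|nS] := pselect (exists y, I y /\ S y).
  exists s => //; exists n.+1; rewrite exprMn exprS exprSr mulrACA.
  by rewrite -yE; apply: is_idealMr.
have S1 : S 1 by exists 1, 0%N; rewrite mulr1; split=> //; apply: carrier1.
have [x1 y1|y Iy Sy|Q [IQ QS]] := @prime_avoidance I S iI S1.
- move=> [s [n [sP ->]]] [t [m [tP ->]]].
  by exists (s * t), (n + m)%N; rewrite exprD mulrACA; split=> //; apply: carrierM.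
- by apply: nS; exists y.
have QP : carrier Q `<=` carrier P.
  move=> y Qy; apply: contrapT => nPy; apply: (QS _ Qy).
  by exists y, 0%N; rewrite mulr1.
have E : Q = P by apply: Max_sub QP; apply: XM; apply: IX.
rewrite -E in Px; case: (QS _ Px); exists 1, 1%N.
by rewrite mul1r expr1; split=> //; apply: carrier1.
Qed.

End Primes.

(** * Invertible ideals with support in a set of primes *)

Section Support.
Variable D : idomainType.
Local Notation K := {fraction D}.
Local Notation "x %:F" := (@FracField.tofrac D x).
Implicit Types (A B I : set D) (J : set K) (P : Spec D) (X : set (Spec D)).

Definition submod J : Prop :=
  [/\ J 0, forall x y, J x -> J y -> J (x + y)
    & forall (a : D) x, J x -> J (a%:F * x)].

Lemma submod_toK A : is_ideal A -> submod (toK A).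
Proof.
move=> iA; split; first by exists 0; [apply: is_ideal0|rewrite tofrac0].
  move=> _ _ [a Aa <-] [b Ab <-]; exists (a + b); first exact: is_idealD.
  exact: rmorphD.
by move=> c _ [a Aa <-]; exists (c * a); [apply: is_idealMl|apply: rmorphM].
Qed.

Lemma notin_neq0 P s : ~ carrier P s -> s%:F != 0.
Proof.
move=> sP; rewrite tofrac_eq0; apply/eqP => s0; apply: sP; rewrite s0.
exact: idealr0.
Qed.

(** The elements of [J D_P] are single fractions: sums can be put over a common
    denominator. *)
Lemma mulI_setloc J P : submod J ->
  mulI J (setloc P) = [set x | exists j s, [/\ J j, ~ carrier P s & x = j / s%:F]].
Proof.
move=> [J0 JD JM]; apply/seteqP; split.
  apply: mulI_sub.
  - by exists 0, 1; split=> //; [apply: carrier1|rewrite mul0r].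
  - move=> _ _ [i [s [Ji sP ->]]] [j [t [Jj tP ->]]].
    exists (t%:F * i + s%:F * j), (s * t); split.
    + by apply: JD; apply: JM.
    + exact: carrierM.
    + by rewrite addf_div ?(notin_neq0 sP) ?(notin_neq0 tP)// rmorphM/= (mulrC i) (mulrC j).
  - move=> j y Jj /asboolP[a [s [/negP sP ->]]]; exists (a%:F * j), s; split=> //.
      exact: JM.
    by rewrite mulrCA mulrA.
move=> _ [j [s [Jj sP ->]]]; apply: mulI_mem => //.
by apply/asboolP; exists 1, s; rewrite tofrac1 div1r; split=> //; apply/negP.
Qed.

(** An element of [A] outside [P] is a unit of [D_P]; conversely, if [A] is
    contained in [P], then [1] is not of the form [a / s]. *)
Lemma supp_toK A P : is_ideal A -> supp (toK A) P <-> A `<=` carrier P.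
Proof.
move=> iA; rewrite /supp /= mulI_setloc; last exact: submod_toK.
split=> [H|AP E].
  apply: contrapT => /nonsubset[a [Aa aP]]; apply: H.
  apply/seteqP; split.
    move=> _ [_ [s [[b Ab <-] sP ->]]]; apply/asboolP; exists b, s.
    by split=> //; apply/negP.
  move=> x /asboolP[b [s [/negP sP ->]]].
  exists (a * b)%:F, (a * s); split; first by exists (a * b) => //; apply: is_idealMr.
    exact: carrierM.
  by rewrite !rmorphM/= -mulf_div divff ?(notin_neq0 aP)// mul1r.
have : setloc P 1 by rewrite /setloc /= rpred1.
rewrite -E => -[_ [s [[a Aa <-] sP]]].
move=> /esym/(canRL (divfK (notin_neq0 sP))); rewrite mul1r => /eqP.
by rewrite tofrac_eq => /eqP sa; apply: sP; rewrite -sa; apply: AP.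
Qed.

(** The ideal [d J], when [d] is a common denominator of [J]. *)
Definition clear_denom (d : D) J : set D := [set a | exists2 j, J j & a%:F = d%:F * j].

Lemma clear_ideal d J : submod J -> is_ideal (clear_denom d J).
Proof.
move=> [J0 JD JM]; split; first by exists 0; rewrite ?tofrac0 ?mulr0.
  move=> x y [i Ji xi] [j Jj yj]; exists (i + j); first exact: JD.
  by rewrite rmorphD/= xi yj mulrDr.
by move=> a x [i Ji xi]; exists (a%:F * i); [apply: JM|rewrite rmorphM/= xi mulrCA].
Qed.

Lemma invertible_clear d J : d != 0 -> (forall x, J x -> toK setT (d%:F * x)) ->
  invertible J -> inv_ideal (clear_denom d J).
Proof.
move=> d0 dJ [_ [J' [J'mod [_ [d' d'0 dJ']]] JJ']].
have iB := clear_ideal d' J'mod.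
exists (clear_denom d' J'), (d * d'); split=> //; first by rewrite mulf_neq0.
have iPr := prin_ideal (d * d').
apply/seteqP; split.
  apply: mulI_sub; [exact: is_ideal0|by move=> x y; apply: is_idealD|].
  move=> a b [i Ji ai] [j Jj bj].
  have [c _ cE] : toK setT (i * j) by rewrite -JJ'; apply: mulI_mem.
  exists c; apply/eqP; rewrite -(tofrac_eq (a * b)) !rmorphM/= ai bj cE.
  by rewrite mulrACA.
have : toK setT (1 : K) by exists 1; rewrite ?tofrac1.
rewrite -JJ' => -[n [i [j [Ji Jj E]]]].
have /choice[a aE] k : exists a, a%:F = d%:F * i k by have [a _] := dJ _ (Ji k); exists a.
have /choice[b bE] k : exists b, b%:F = d'%:F * j k by have [b _] := dJ' _ (Jj k); exists b.
have -> : d * d' = \sum_k a k * b k.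
  apply/eqP; rewrite -tofrac_eq rmorph_sum tofracM -[_ * _]mulr1 E mulr_sumr/=; apply/eqP.
  by apply: eq_bigr => k _; rewrite rmorphM/= aE bE mulrACA.
move=> _ [c ->]; rewrite mulIC; apply: is_idealMr; first exact: mulI_ideal.
apply: ideal_sum; first exact: mulI_ideal.
by move=> k; rewrite mulrC; apply: mulI_mem; [exists (j k)|exists (i k)].
Qed.

Lemma invertible_toK A : invertible (toK A) -> inv_ideal A.
Proof.
move=> /(@invertible_clear 1); rewrite oner_eq0 tofrac1.
suff -> : clear_denom 1 (toK A) = A.
  by apply=> // x [a _ <-]; exists a; rewrite ?mul1r.
apply/seteqP; split=> a; last by move=> Aa; exists a%:F; [exists a|rewrite tofrac1 mul1r].
by move=> [_ [b Ab <-]]; rewrite tofrac1 mul1r => /eqP; rewrite tofrac_eq => /eqP ->.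
Qed.

Lemma prufer_inv A : prufer D -> fin_gen A -> (exists2 a, A a & a != 0) ->
  invertible (toK A).
Proof.
move=> hD fA [a Aa a0]; apply: hD => // A0.
by rewrite A0 in Aa; rewrite Aa eqxx in a0.
Qed.

(** This expresses membership in [Inv_X(D)] by ideals and primes of [D] alone.
    The Pruefer property enters because it turns a finitely generated ideal back
    into an invertible one. *)
Lemma Inv_toK X A : prufer D -> is_ideal A ->
  Inv_ X (toK A) <-> inv_ideal A /\ VI A `<=` X.
Proof.
move=> hD iA; split=> [[/invertible_toK invA sX]|[invA AX]]; split=> //.
- by move=> P AP; apply: sX; apply/supp_toK.
- by apply: prufer_inv => //; [apply: inv_ideal_fin_gen|apply: inv_ideal_neq0].
- by move=> P /(supp_toK _ iA); apply: AX.
Qed.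

End Support.

(** * The discrete valuation at a prime of [X] *)

(** In a Pruefer domain, for [P] maximal and different from its square, this [n]
    is the exponent in [A D_P = P ^ n D_P]. *)
Definition has_ord (D : idomainType) (P : Spec D) (A : set D) (n : nat) : Prop :=
  A `<=` expI (carrier P) n /\ ~ A `<=` expI (carrier P) n.+1.

Section Uniformizer.
Variables (D : idomainType) (P : Spec D) (p : D).
Hypotheses (hD : prufer D) (mP : Max D P).
Hypotheses (Pp : carrier P p) (P2p : ~ expI (carrier P) 2 p).
Implicit Types (A B : set D) (x s c : D).
Local Notation Pn := (expI (carrier P)).

Let iP : is_ideal (carrier P) := carrier_ideal P.
Let iPn n : is_ideal (Pn n) := expI_ideal n iP.

(** [D_P] is a valuation ring: if [d = a u + b v] generates the product of
    [(a, b)] with its inverse, then one of [a u / d], [b v / d] lies outside [P]. *)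
Lemma local_total (a b : D) :
  (exists s c, ~ carrier P s /\ s * a = c * b) \/
  (exists s c, ~ carrier P s /\ s * b = c * a).
Proof.
have [->|b0] := eqVneq b 0.
  by right; exists 1, 0; rewrite mulr0 mul0r; split=> //; apply: carrier1.
have iI : is_ideal (addI (prin a) (prin b)) by apply: addI_ideal; apply: prin_ideal.
have Ia : addI (prin a) (prin b) a by apply: addI_subl; [exact: prin_ideal|exact: prin_mem].
have Ib : addI (prin a) (prin b) b by apply: addI_subr; [exact: prin_ideal|exact: prin_mem].
have [|B [d [iB d0 IB]]] := @invertible_toK D (addI (prin a) (prin b)).
  apply: prufer_inv => //; last by exists b.
  by apply: fin_gen_add; apply: fin_gen_prin.
have : mulI (addI (prin a) (prin b)) B d by rewrite IB; apply: prin_mem.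
have sub : mulI (addI (prin a) (prin b)) B `<=`
    [set x | exists u v, [/\ B u, B v & x = a * u + b * v]].
  apply: mulI_sub.
  - by exists 0, 0; rewrite !mulr0 addr0; split=> //; apply: is_ideal0.
  - move=> _ _ [u [v [Bu Bv ->]]] [w [z [Bw Bz ->]]].
    by exists (u + w), (v + z); rewrite !mulrDr addrACA; split=> //; apply: is_idealD.
  - move=> _ e [_ [_ [[c ->] [c' ->] ->]]] Be; exists (c * e), (c' * e).
    by rewrite mulrDl !mulrA; split=> //; apply: is_idealMl.
move=> /sub[u [v [Bu Bv dE]]].
have dvd x y : addI (prin a) (prin b) x -> B y -> exists c, x * y = d * c.
  by move=> Ix By; have := mulI_mem Ix By; rewrite IB.
have [al auE] := dvd _ _ Ia Bu; have [be avE] := dvd _ _ Ia Bv.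
have [ga buE] := dvd _ _ Ib Bu; have [de bvE] := dvd _ _ Ib Bv.
have sum1 : al + de = 1 by apply: (mulfI d0); rewrite mulrDr -auE -bvE mulr1.
have [Pal|nPal] := pselect (carrier P al); last first.
  right; exists al, ga; split=> //; apply: (mulfI d0).
  by rewrite mulrA -auE mulrA -buE mulrAC (mulrC a) [RHS]mulrAC.
left; exists de, be; split.
  by move=> Pde; apply: (@carrier1 _ P); rewrite -sum1; apply: is_idealD.
by apply: (mulfI d0); rewrite mulrA -bvE mulrA -avE mulrAC (mulrC b) [RHS]mulrAC.
Qed.

Lemma unif_neq0 : p != 0.
Proof. by apply/eqP => p0; apply: P2p; rewrite p0; apply: is_ideal0; apply: iPn. Qed.

(** [p] generates [P D_P]: otherwise [p] would be a multiple, by an element of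
    [P], of some [x] in [P], up to a factor outside [P], and so lie in [P ^ 2]. *)
Lemma unif_dvd x : carrier P x -> exists s c, ~ carrier P s /\ s * x = c * p.
Proof.
move=> Px; have [//|[s [c [sP E]]]] := local_total x p.
have [Pc|nPc] := pselect (carrier P c); last by exists c, s.
case: P2p; apply: (expI_primary mP sP); rewrite E.
by have := mulI_mem Pc (mulI_mem Px (I : setT 1)); rewrite mulr1.
Qed.

Lemma unif_dvdX n x : Pn n x -> exists s c, ~ carrier P s /\ s * x = c * p ^+ n.
Proof.
elim: n x => [|n IH] x Px.
  by exists 1, x; rewrite mul1r mulr1; split=> //; apply: carrier1.
have := Px; rewrite /expI iterS.
have -> : (iter n (mulI (carrier P)) setT) = Pn n by [].
apply: (@mulI_sub _ _ _ [set x | exists s c, ~ carrier P s /\ s * x = c * p ^+ n.+1]).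
- by exists 1, 0; rewrite mulr0 mul0r; split=> //; apply: carrier1.
- move=> y z [s [c [sP yE]]] [t [e [tP zE]]]; exists (s * t), (t * c + s * e).
  split; first exact: carrierM.
  rewrite mulrDr mulrDl; congr (_ + _); last by rewrite -!mulrA zE.
  by rewrite (mulrC s) -!mulrA yE.
- move=> a b /unif_dvd[s [c [sP aE]]] /IH[t [e [tP bE]]]; exists (s * t), (c * e).
  by split; [apply: carrierM|rewrite mulrACA aE bE mulrACA exprS].
Qed.

Lemma unif_exp n : ~ Pn n.+1 (p ^+ n).
Proof.
move=> /unif_dvdX[s [c [sP]]]; rewrite exprS mulrA => /mulIf E.
apply: sP; rewrite E ?expf_neq0 ?unif_neq0//; exact: is_idealMl.
Qed.

Lemma ord_unif n x : Pn n x -> ~ Pn n.+1 x ->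
  exists s t, [/\ ~ carrier P s, ~ carrier P t & s * x = t * p ^+ n].
Proof.
move=> /unif_dvdX[s [t [sP E]]] nx; exists s, t; split=> // Pt; apply: nx.
apply: (expI_primary mP sP); rewrite E /expI iterS; apply: mulI_mem => //.
exact: expI_exp.
Qed.

Lemma unif_ord n x s t : ~ carrier P s -> ~ carrier P t -> s * x = t * p ^+ n ->
  Pn n x /\ ~ Pn n.+1 x.
Proof.
move=> sP tP E; split.
  by apply: (expI_primary mP sP); rewrite E; apply: is_idealMl => //; apply: expI_exp.
by move=> Px; apply: (@unif_exp n); apply: (expI_primary mP tP); rewrite -E; apply: is_idealMl.
Qed.

Lemma has_ord_ex A : ~ A `<=` \bigcap_k Pn k.+1 -> exists n, has_ord P A n.
Proof.
move=> nQ; have ex : exists k, ~~ `[< A `<=` Pn k.+1 >].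
  apply: contrapT => H; apply: nQ => x Ax k _; apply: contrapT => nP; apply: H.
  by exists k; apply/asboolP => /(_ _ Ax).
have [[|n] /asboolP nP min] := ex_minnP ex; first by exists 0%N.
exists n.+1; split=> //; apply: contrapT => nP'.
by have := min n; rewrite ltnn => H; apply: notF; apply: H; apply/asboolP.
Qed.

Lemma ord_ex x : ~ (\bigcap_k Pn k.+1) x -> exists n, Pn n x /\ ~ Pn n.+1 x.
Proof.
move=> nQ; have [|n [Px nPx]] := @has_ord_ex [set x]; first by move=> /(_ x erefl).
by exists n; split; [apply: Px|move=> H; apply: nPx => _ ->].
Qed.

(** An element outside the intersection is, up to factors outside [P], a power of
    [p], and products of powers of [p] are powers of [p]. *)
Lemma bigcap_expI_prime : exists Q, carrier Q = \bigcap_k Pn k.+1.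
Proof.
apply: Spec_of.
- split; first by move=> k _; apply: is_ideal0.
    by move=> x y Qx Qy k _; apply: is_idealD; [|exact: Qx|exact: Qy].
  by move=> a x Qx k _; apply: is_idealMl => //; apply: Qx.
- by move=> /(_ 0 I); rewrite expI1//; apply: carrier1.
- move=> x y Qxy; apply: contrapT => /not_orP[/ord_ex[n [Px nPx]] /ord_ex[m [Py nPy]]].
  have [s [t [sP tP xE]]] := ord_unif Px nPx; have [s' [t' [sP' tP' yE]]] := ord_unif Py nPy.
  have [|_] := @unif_ord (n + m) (x * y) (s * s') (t * t') (carrierM sP sP') (carrierM tP tP').
    by rewrite mulrACA xE yE mulrACA exprD.
  by apply; apply: Qxy.
Qed.

End Uniformizer.

(** * Orders of ideals *)

Section Order.
Variables (D : idomainType) (P : Spec D).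
Hypotheses (hD : prufer D) (mP : Max D P).
Hypothesis (nP : carrier P <> mulI (carrier P) (carrier P)).
Implicit Types (A B I : set D) (X : set (Spec D)).
Local Notation Pn := (expI (carrier P)).
Let iP : is_ideal (carrier P) := carrier_ideal P.
Let iPn n : is_ideal (Pn n) := expI_ideal n iP.

Lemma expI2 : Pn 2 = mulI (carrier P) (carrier P).
Proof. by rewrite /expI /= (mulIC _ setT) mulTI. Qed.

Lemma ex_unif : exists p, carrier P p /\ ~ Pn 2 p.
Proof.
apply: contrapT => H; apply: nP; rewrite -expI2; apply/seteqP; split.
  by move=> x Px; apply: contrapT => nPx; apply: H; exists x.
by rewrite expI2; apply: mulI_subl.
Qed.

Lemma has_ordM A B n m : has_ord P A n -> has_ord P B m -> has_ord P (mulI A B) (n + m).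
Proof.
move=> [An /nonsubset[a [Aa nA]]] [Bm /nonsubset[b [Bb mB]]]; split.
  by rewrite expID//; apply: mulIS.
have [p [Pp P2p]] := ex_unif.
have [s [t [sP tP aE]]] := ord_unif hD mP Pp P2p (An _ Aa) nA.
have [s' [t' [sP' tP' bE]]] := ord_unif hD mP Pp P2p (Bm _ Bb) mB.
have [|_ nab] := @unif_ord _ _ _ hD mP Pp P2p (n + m) (a * b) (s * s') (t * t')
  (carrierM sP sP') (carrierM tP tP').
  by rewrite mulrACA aE bE mulrACA exprD.
by move=> /(_ _ (mulI_mem Aa Bb)).
Qed.

(** An ideal contained in no prime outside [X] escapes the prime just below
    [P], which is not maximal. *)
Lemma supp_not_sub_bigcap X A : X `<=` Max D -> VI A `<=` X ->
  ~ A `<=` \bigcap_k Pn k.+1.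
Proof.
move=> XM AX; have [p [Pp P2p]] := ex_unif.
have [Q QE] := bigcap_expI_prime hD mP Pp P2p.
rewrite -QE => /AX/XM mQ; have QP : carrier Q `<=` carrier P.
  by rewrite QE -{2}(expI1 iP) => x /(_ 0%N I).
by move: Pp; rewrite -(Max_sub mQ QP) QE => /(_ 1%N I).
Qed.

End Order.

(** * Values of fractional ideals *)

(** A normalized valuation is determined by its ring: it vanishes exactly on the
    units, so [v' x = v x * v' u] for [u] of value 1. *)
Lemma normalized_valuation_uniq (F : fieldType) (V : set F) (v v' : F -> int) :
  normalized_valuation V v -> normalized_valuation V v' ->
  forall x, x != 0 -> v x = v' x.
Proof.
have basics w : normalized_valuation V w ->
    [/\ forall x, x != 0 -> w x^-1 = - w x,
        forall x n, x != 0 -> w (x ^+ n) = w x *+ n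
      & forall x, x != 0 -> V x <-> 0 <= w x].
  move=> [wM _ _ VE]; have w1 : w 1 = 0.
    by apply: (addrI (w 1)); rewrite -wM ?oner_eq0// mulr1 addr0.
  split.
  - move=> x x0; apply/eqP; rewrite -addr_eq0 addrC eq_sym -w1.
    by rewrite -wM ?invr_eq0// divff.
  - move=> x n x0; elim: n => [|n IH]; first by rewrite expr0 w1.
    by rewrite exprS wM ?expf_neq0// IH mulrS.
  - by move=> x x0; rewrite VE; split=> [[/eqP|//]|]; [rewrite (negbTE x0)|right].
move=> nv nv'; have [vV vX Vv] := basics _ nv; have [v'V v'X Vv'] := basics _ nv'.
have [vM _ [u u0 u1] _] := nv; have [v'M _ [z z0 z1] _] := nv'.
have same x : x != 0 -> (0 <= v x) = (0 <= v' x).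
  move=> x0; apply/idP/idP => [/(Vv x x0)/(Vv' x x0)//|/(Vv' x x0)/(Vv x x0)//].
have units x : x != 0 -> v x = 0 -> v' x = 0.
  move=> x0 vx; apply/eqP; rewrite eq_le -[v' x <= 0]oppr_ge0 -v'V//.
  by rewrite -!same ?invr_eq0// vV// vx oppr0.
have u'0 : 0 <= v' u by rewrite -same// u1.
have pos x n : x != 0 -> v x = n%:Z -> v' x = v' u *+ n.
  move=> x0 xn; apply/eqP; rewrite -subr_eq0 -v'X// -v'V ?expf_neq0//.
  rewrite -v'M ?invr_eq0 ?expf_neq0//; apply/eqP; apply: units.
    by rewrite mulf_neq0// invr_eq0 expf_neq0.
  by rewrite vM ?invr_eq0 ?expf_neq0// vV ?expf_neq0// vX// u1 xn natz subrr.
have [n zn] : exists n : nat, v z = n%:Z.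
  have : 0 <= v z by rewrite same// z1.
  by case: (v z) => // n _; exists n.
(* [v' u] is a nonnegative divisor of [1 = v' z]. *)
have u'1 : v' u = 1.
  have := pos _ _ z0 zn; rewrite z1.
  case: (v' u) u'0 => // m _ /esym; rewrite -mulr_natl natz -PoszM => -[/eqP].
  by rewrite muln_eq1 => /andP[_ /eqP ->].
move=> x x0; case E : (v x) => [k|k]; first by rewrite (pos x k)// u'1 natz.
apply: oppr_inj; rewrite -v'V// (pos _ k.+1) ?invr_eq0// ?vV// ?E ?NegzE ?opprK//.
by rewrite u'1 natz.
Qed.

Lemma ideal_value_uniq (F : fieldType) (v v' : F -> int) (J : set F) n n' :
  (forall x, x != 0 -> v x = v' x) ->
  ideal_value v J n -> ideal_value v' J n' -> n = n'.
Proof.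
move=> vv' [[x [Jx x0 <-]] minx] [[y [Jy y0 <-]] miny].
by apply/eqP; rewrite eq_le {2}vv'// miny// -vv'// minx.
Qed.

Lemma is_w_uniq (D : idomainType) (P : Spec D) J n n' :
  is_w P J n -> is_w P J n' -> n = n'.
Proof.
move=> [Q [v [QE nv wv]]] [Q' [v' [Q'E nv' wv']]].
have E : Q' = Q by apply: Spec_inj; rewrite QE Q'E.
move: v' nv' wv'; rewrite E => v' nv' wv'.
by apply: ideal_value_uniq wv wv'; apply: normalized_valuation_uniq nv nv'.
Qed.

Section Residue.
Variables (D : idomainType) (P Q : Spec D) (p : D).
Hypotheses (hD : prufer D) (mP : Max D P).
Hypotheses (Pp : carrier P p) (P2p : ~ expI (carrier P) 2 p).
Hypothesis (QE : carrier Q = \bigcap_k expI (carrier P) k.+1).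
Local Notation K := {fraction D}.
Local Notation "x %:F" := (@FracField.tofrac D x).
Local Notation pi := p%:F.
Implicit Types (x y z u m : K) (k l : int) (s t a c : D).

Let iP : is_ideal (carrier P) := carrier_ideal P.

Let pi0 : pi != 0.
Proof. by rewrite tofrac_eq0; apply: unif_neq0 P2p. Qed.

Let nzP s : ~ carrier P s -> s%:F != 0. Proof. exact: notin_neq0. Qed.

(** The units of [D_P], and its maximal ideal. *)
Definition loc_unit (u : K) : Prop :=
  exists s t, [/\ ~ carrier P s, ~ carrier P t & u = t%:F / s%:F].
Definition locmax (m : K) : Prop :=
  exists s c, [/\ ~ carrier P s, carrier P c & m = c%:F / s%:F].

Lemma loc_unit1 : loc_unit 1.
Proof. by exists 1, 1; rewrite tofrac1 divr1; split=> //; apply: carrier1. Qed.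

Lemma loc_unitM u x : loc_unit u -> loc_unit x -> loc_unit (u * x).
Proof.
move=> [s [t [sP tP ->]]] [s' [t' [sP' tP' ->]]]; exists (s * s'), (t * t').
by split; [exact: carrierM|exact: carrierM|rewrite mulf_div !rmorphM].
Qed.

Lemma loc_unitV u : loc_unit u -> loc_unit u^-1.
Proof. by move=> [s [t [sP tP ->]]]; exists t, s; rewrite invf_div. Qed.

Lemma loc_unit_neq0 u : loc_unit u -> u != 0.
Proof. by move=> [s [t [sP tP ->]]]; rewrite mulf_neq0 ?invr_eq0 ?nzP. Qed.

Lemma loc_unit_loc u : loc_unit u -> u \in loc P.
Proof. by move=> [s [t [/negP sP tP ->]]]; apply/asboolP; exists t, s. Qed.

Lemma loc_unit_add u m : loc_unit u -> locmax m -> loc_unit (u + m).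
Proof.
move=> [s [t [sP tP ->]]] [s' [c [sP' Pc ->]]].
exists (s * s'), (t * s' + c * s); split; first exact: carrierM.
  move=> H; apply: (carrierM tP sP'); rewrite -[t * s'](addrK (c * s)).
  apply: is_idealD => //; rewrite -mulNr; apply: is_idealMr => //.
  by rewrite -mulN1r; apply: is_idealMl.
by rewrite addf_div ?nzP// rmorphD !rmorphM.
Qed.

Lemma loc_unit_locmax u : loc_unit u -> ~ locmax u.
Proof.
move=> [s [t [sP tP ->]]] [s' [c [sP' Pc /eqP]]].
rewrite eqr_div ?nzP// -!tofracM tofrac_eq => /eqP E.
by apply: (carrierM tP sP'); rewrite E; apply: is_idealMr.
Qed.

Lemma locmaxM m z : locmax m -> z \in loc P -> locmax (m * z).
Proof.
move=> [s [c [sP Pc ->]]] /asboolP[a [t [/negP tP ->]]]; exists (s * t), (c * a).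
by split; [exact: carrierM|exact: is_idealMr|rewrite mulf_div !rmorphM].
Qed.

Lemma locmaxX n : (0 < n)%N -> locmax (pi ^+ n).
Proof.
case: n => // n _; exists 1, (p ^+ n.+1); rewrite tofrac1 divr1 rmorphXn.
by split=> //; [apply: carrier1|rewrite exprS; apply: is_idealMr].
Qed.

Lemma loc_pi n : pi ^+ n \in loc P.
Proof. by rewrite rpredX//; apply/asboolP; exists p, 1; rewrite idealr1 tofrac1 divr1. Qed.

(** The valuation of [D_P / Q D_P] before reduction modulo [Q]: the elements of
    [K] that have a value are those of [D_Q] outside its maximal ideal. *)
Definition has_val x k : Prop := exists2 u, loc_unit u & x = u * pi ^ k.

Lemma has_val_neq0 x k : has_val x k -> x != 0.
Proof. by move=> [u /loc_unit_neq0 u0 ->]; rewrite mulf_neq0// expfz_neq0. Qed.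

Lemma has_valM x y k l : has_val x k -> has_val y l -> has_val (x * y) (k + l).
Proof.
move=> [u Uu ->] [z Uz ->]; exists (u * z); first exact: loc_unitM.
by rewrite mulrACA expfzDr.
Qed.

Lemma has_valV x k : has_val x k -> has_val x^-1 (- k).
Proof.
by move=> [u Uu ->]; exists u^-1; [exact: loc_unitV|rewrite invfM invr_expz].
Qed.

Lemma has_val_pi k : has_val (pi ^ k) k.
Proof. by exists 1; [exact: loc_unit1|rewrite mul1r]. Qed.

Lemma has_val_loc x k : has_val x k -> (x \in loc P) = (0 <= k).
Proof.
move=> [u Uu ->]; apply/idP/idP.
  case: k => // n /(locmaxM (locmaxX (ltn0Sn n))).
  rewrite mulrCA NegzE -exprnN divff ?expf_neq0// mulr1.
  by move/(loc_unit_locmax Uu).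
by case: k => // n _; rewrite rpredM ?loc_pi//; apply: loc_unit_loc.
Qed.

Lemma has_val_uniq x k l : has_val x k -> has_val x l -> k = l.
Proof.
have le k' l' : has_val x k' -> has_val x l' -> k' <= l'.
  move=> xk xl; have x0 := has_val_neq0 xk; have := has_valM xl (has_valV xk).
  by rewrite divff// => /has_val_loc; rewrite rpred1 subr_ge0.
by move=> xk xl; apply/eqP; rewrite eq_le !le.
Qed.

Lemma has_val_ord n a : expI (carrier P) n a -> ~ expI (carrier P) n.+1 a -> has_val a%:F n.
Proof.
move=> an na; have [s [t [sP tP E]]] := ord_unif hD mP Pp P2p an na.
exists (t%:F / s%:F); first by exists s, t.
rewrite mulrAC; apply: (canRL (mulfK (nzP sP))).
by rewrite mulrC -tofracM E tofracM rmorphXn.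
Qed.

Lemma loc_ord n a : expI (carrier P) n a -> a%:F / pi ^ n \in loc P.
Proof.
move=> /(unif_dvdX hD mP P2p)[s [c [sP E]]].
have -> : a%:F / pi ^ n = c%:F / s%:F.
  apply/eqP; rewrite eqr_div ?nzP ?expfz_neq0// -tofracM mulrC E tofracM rmorphXn.
  by [].
by apply/asboolP; exists c, s; split=> //; apply/negP.
Qed.

Lemma has_val_notQ a : ~ carrier Q a -> exists n : nat, has_val a%:F n.
Proof. by rewrite {1}QE => /ord_ex[n [an na]]; exists n; apply: has_val_ord. Qed.

(** The maximal ideal of [D_Q] is contained in [pi ^ k P D_P] for every [k], so
    that adding one of its elements does not change values. *)
Lemma Q_locmax a c k : carrier Q a -> ~ carrier Q c ->
  exists2 m, locmax m & a%:F / c%:F = m * pi ^ k.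
Proof.
move=> Qa /has_val_notQ[n [u Uu cE]].
(* The denominator costs [n] powers of [p], and [pi ^ k] at most [`|k|]; one
   more leaves a factor in [P]. *)
have [s [e [sP aE]]] : exists s e, ~ carrier P s /\ s * a = e * p ^+ (n + `|k|).+1.
  by apply: (unif_dvdX hD mP P2p); move: Qa; rewrite QE; apply.
exists (pi * (pi ^ (`|k|%:Z - k) * (e%:F / s%:F / u))).
  apply: locmaxM; first by have := locmaxX (ltn0Sn 0); rewrite expr1.
  apply: rpredM.
    have : 0 <= `|k|%:Z - k by rewrite subr_ge0 abszE ler_norm.
    by case: (_ - k) => // j _; apply: loc_pi.
  apply: rpredM; last exact/loc_unit_loc/loc_unitV.
  by apply/asboolP; exists e, s; split=> //; apply/negP.
have -> : a%:F = e%:F / s%:F * pi ^+ (n + `|k|).+1.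
  apply: (mulfI (nzP sP)); rewrite -tofracM aE tofracM rmorphXn mulrA.
  by rewrite [s%:F * _]mulrC divfK ?nzP.
have -> : pi ^+ (n + `|k|).+1 = pi * (pi ^ (`|k|%:Z - k) * pi ^ k) * pi ^ n.
  by rewrite -expfzDr// subrK exprS addnC exprD mulrA.
move: (e%:F / s%:F) => W; rewrite cE mulrA -mulf_div divff ?expfz_neq0// mulr1 -!mulrA.
by rewrite (mulrCA W) (mulrCA W) (mulrC _ u^-1).
Qed.

Lemma locQ_notP (x : locT Q) : to_resf x = 0 <-> x \in @locM D Q.
Proof.
rewrite /to_resf -[0](rmorph0 (\pi_({ideal_quot (@locM D Q)}))%qT).
split=> [/eqP|H]; first by rewrite -Quotient.idealrBE subr0.
by apply/eqP; rewrite -Quotient.idealrBE subr0.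
Qed.

Lemma to_resf_eq (x y : locT Q) : to_resf x = to_resf y <-> x - y \in @locM D Q.
Proof.
by rewrite /to_resf; split=> [/eqP|H]; [|apply/eqP]; rewrite -Quotient.idealrBE.
Qed.

Lemma to_resfM (x y : locT Q) : to_resf (x * y) = to_resf x * to_resf y.
Proof. by rewrite /to_resf rmorphM. Qed.

Lemma to_resfD (x y : locT Q) : to_resf (x + y) = to_resf x + to_resf y.
Proof. by rewrite /to_resf rmorphD. Qed.

Lemma to_resf_surj (y : resf Q) : exists x : locT Q, y = to_resf x.
Proof. by exists (repr y); rewrite /to_resf reprK. Qed.

Lemma QsubP a : carrier Q a -> carrier P a.
Proof. by rewrite QE => /(_ 0%N I); rewrite expI1. Qed.

Lemma loc_sub x : x \in loc P -> x \in loc Q.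
Proof.
move=> /asboolP[a [s [/negP sP ->]]]; apply/asboolP; exists a, s; split=> //.
by apply/negP => /QsubP.
Qed.

Lemma pi_notQ : ~ carrier Q p.
Proof. by rewrite QE => /(_ 1%N I). Qed.

Lemma has_val_locQ x k : has_val x k -> x \in loc Q.
Proof.
move=> [u /loc_unit_loc/loc_sub Qu ->]; apply: rpredM => //.
case: k => n; first by apply: loc_sub; apply: loc_pi.
rewrite NegzE -exprnN -exprVn rpredX//; apply/asboolP; exists 1, p.
by rewrite tofrac1 div1r; split=> //; apply/negP; apply: pi_notQ.
Qed.

Lemma has_val_notin x k : has_val x k -> forall a c, carrier Q a -> ~ carrier Q c ->
  x <> a%:F / c%:F.
Proof.
move=> [u Uu ->] a c Qa Qc; have [m mm ->] := Q_locmax k Qa Qc.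
by move=> /(mulIf (expfz_neq0 _ pi0)) E; apply: (loc_unit_locmax Uu); rewrite E.
Qed.

Lemma has_val_add x k a c : has_val x k -> carrier Q a -> ~ carrier Q c ->
  has_val (x + a%:F / c%:F) k.
Proof.
move=> [u Uu ->] Qa Qc; have [m mm ->] := Q_locmax k Qa Qc.
by exists (u + m); [exact: loc_unit_add|rewrite mulrDl].
Qed.

Definition res_has_val (y : resf Q) k : Prop :=
  exists2 x : locT Q, y = to_resf x & has_val (val x) k.

Lemma res_has_val_neq0 (y : resf Q) k : res_has_val y k -> y != 0.
Proof.
move=> [x -> xk]; apply/eqP => /locQ_notP/asboolP[a [s [Qa /negP Qs E]]].
exact: (has_val_notin xk Qa Qs).
Qed.

Lemma res_has_val_ex (y : resf Q) : y != 0 -> exists k, res_has_val y k.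
Proof.
have [x ->] := to_resf_surj y; move=> x0.
have /asboolP[a [s [/negP Qs E]]] := valP x.
have Qa : ~ carrier Q a.
  move=> Qa; move/eqP: x0; apply; apply/locQ_notP/asboolP.
  by exists a, s; split=> //; apply/negP.
have [n an] := has_val_notQ Qa; have [m sm] := has_val_notQ Qs.
exists (n%:Z - m%:Z); exists x => //; rewrite E.
by apply: has_valM => //; apply: has_valV.
Qed.

Lemma res_has_val_val (x : locT Q) k : res_has_val (to_resf x) k -> has_val (val x) k.
Proof.
move=> [z /to_resf_eq/asboolP[a [s [Qa /negP Qs E]]] zk].
have -> : val x = val z + a%:F / s%:F by rewrite -E rmorphB addrC subrK.
exact: has_val_add.
Qed.

Lemma res_has_val_uniq (y : resf Q) k l : res_has_val y k -> res_has_val y l -> k = l.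
Proof. by move=> [x -> xk] /res_has_val_val; apply: has_val_uniq. Qed.

(** The value at [0] is a placeholder. *)
Definition res_val (y : resf Q) : int := xget 0 [set k | res_has_val y k].

Lemma res_valE (y : resf Q) k : res_has_val y k -> res_val y = k.
Proof.
move=> yk; rewrite /res_val; case: xgetP => [l _ yl|/(_ k)//].
exact: res_has_val_uniq yl yk.
Qed.

Lemma res_valP (y : resf Q) : y != 0 -> res_has_val y (res_val y).
Proof. by move=> /res_has_val_ex[k yk]; rewrite (res_valE yk). Qed.

Lemma res_has_valM (y z : resf Q) k l : res_has_val y k -> res_has_val z l ->
  res_has_val (y * z) (k + l).
Proof.
move=> [x -> xk] [x' -> xl]; exists (x * x'); first by rewrite to_resfM.
by rewrite rmorphM; apply: has_valM.
Qed.

Lemma res_valM (y z : resf Q) : y != 0 -> z != 0 -> res_val (y * z) = res_val y + res_val z.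
Proof. by move=> y0 z0; apply: res_valE; apply: res_has_valM; apply: res_valP. Qed.

Lemma res_valD (y z : resf Q) : y != 0 -> z != 0 -> y + z != 0 ->
  Num.min (res_val y) (res_val z) <= res_val (y + z).
Proof.
have le (t w : resf Q) : t != 0 -> w != 0 -> t + w != 0 -> res_val t <= res_val w ->
    res_val t <= res_val (t + w).
  move=> t0 w0 tw0 tw.
  have [[x xE xk] [x' x'E xl]] := (res_valP t0, res_valP w0).
  have := res_valP tw0; rewrite {1}xE {1}x'E -to_resfD => /res_has_val_val; rewrite rmorphD/=.
  move=> /has_valM/(_ (has_valV xk)) H; rewrite -subr_ge0 -(has_val_loc H).
  rewrite mulrDl divff ?(has_val_neq0 xk)//.
  by rewrite rpredD ?rpred1// (has_val_loc (has_valM xl (has_valV xk))) subr_ge0.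
move=> y0 z0 yz0; rewrite ge_min.
have [yz|/ltW zy] := leP (res_val y) (res_val z); first by rewrite le.
have zy0 : z + y != 0 by rewrite (addrC z).
by apply/orP; right; rewrite (addrC y); exact: (le _ _ z0 y0 zy0 zy).
Qed.

Lemma res_has_val_pi k (pQ : pi ^ k \in loc Q) :
  res_has_val (to_resf (exist (fun x => x \in loc Q) _ pQ)) k.
Proof. by exists (exist (fun x => x \in loc Q) _ pQ) => //; apply: has_val_pi. Qed.

Lemma res_val_ring : @modQ D Q (setloc P) = [set y | y = 0 \/ 0 <= res_val y].
Proof.
apply/seteqP; split=> y.
  move=> [x Px ->] /=; have [->|x0] := eqVneq (to_resf x) 0; [by left|right].
  by rewrite -(has_val_loc (res_has_val_val (res_valP x0))).
have [->|y0] := eqVneq y 0.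
  by move=> _; exists 0; [exact: (rpred0 (@loc D P))|apply/esym/locQ_notP; rewrite rpred0].
case=> [yy|]; first by rewrite yy eqxx in y0.
by have [x -> xk] := res_valP y0; exists x => //; rewrite /setloc /= (has_val_loc xk).
Qed.

Lemma res_val_normalized : normalized_valuation (@modQ D Q (setloc P)) res_val.
Proof.
split; [exact: res_valM|exact: res_valD| |exact: res_val_ring].
have H := res_has_val_pi (has_val_locQ (has_val_pi 1)).
by eexists; [exact: res_has_val_neq0 H|exact: res_valE H].
Qed.

(** The hypothesis says that [J D_P = pi ^ k D_P], an ideal whose least value is
    reached at [pi ^ k]. *)
Lemma is_wI (J : set K) k :
  (forall x, mulI J (setloc P) x <-> x / pi ^ k \in loc P) -> is_w P J k.
Proof.
move=> JE; exists Q, res_val; split=> //; first exact: res_val_normalized.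
have pk0 : pi ^ k != 0 by rewrite expfz_neq0.
split.
  have pQ := has_val_locQ (has_val_pi k); have H := res_has_val_pi pQ.
  eexists; split; [|exact: res_has_val_neq0 H|exact: res_valE H].
  by exists (exist (fun x => x \in loc Q) _ pQ) => //=; apply/JE; rewrite divff ?rpred1.
move=> _ [x /JE Jx ->] /res_valP/res_has_val_val H.
by rewrite -subr_ge0 -(has_val_loc (has_valM H (has_valV (has_val_pi k)))).
Qed.

(** Locally [A] and [B] are generated by [pi ^ n] and [pi ^ m], and the conditions
    on [J] say that [J B = A]. *)
Lemma is_w_quot (J : set K) (A B : set D) (n m : nat) :
  has_ord P A n -> has_ord P B m ->
  (forall j b, J j -> B b -> toK A (j * b%:F)) ->
  (forall a, A a -> mulI J (toK B) a%:F) -> is_w P J (n%:Z - m%:Z).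
Proof.
move=> [An /nonsubset[a [Aa nA]]] [Bm /nonsubset[b [Bb mB]]] JBA AJB.
have an := has_val_ord (An _ Aa) nA; have bm := has_val_ord (Bm _ Bb) mB.
have kE : pi ^ (n%:Z - m%:Z) = pi ^ n / pi ^ m by rewrite expfzDr// invr_expz.
have pn0 : pi ^ n != 0 by rewrite expfz_neq0.
have pm0 : pi ^ m != 0 by rewrite expfz_neq0.
apply: is_wI => x; rewrite kE; split.
  move: x; apply: (@mulI_sub _ _ _ [set x | x / (pi ^ n / pi ^ m) \in loc P]) => /=.
  - by rewrite mul0r rpred0.
  - by move=> x y; rewrite mulrDl; apply: rpredD.
  - move=> j y Jj Py; rewrite mulrAC; apply: rpredM => //.
    have [a' Aa' E] := JBA _ _ Jj Bb.
    have -> : j / (pi ^ n / pi ^ m) = (a'%:F / pi ^ n) * (pi ^ m / b%:F).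
      by rewrite E mulf_div invf_div (mulrAC j) -mulf_div divff ?(has_val_neq0 bm)// mulr1 mulrA.
    apply: rpredM; first by apply: loc_ord; apply: An.
    by rewrite (has_val_loc (has_valM (has_val_pi m) (has_valV bm))) subrr.
move=> xP; have [k [j [b' [Jj Bb' E]]]] := AJB _ Aa.
rewrite -[x](divfK (_ : pi ^ n / pi ^ m != 0)); last by rewrite mulf_neq0 ?invr_eq0.
move: (x / _) xP => z zP; have -> : pi ^ n / pi ^ m = (pi ^ n / a%:F) * (a%:F / pi ^ m).
  by rewrite mulrA divfK ?(has_val_neq0 an).
rewrite mulrA mulIC; apply: mulI_scale => [y Py|].
  apply: rpredM => //; apply: rpredM => //.
  by rewrite (has_val_loc (has_valM (has_val_pi n) (has_valV an))) subrr.
rewrite E mulr_suml; apply: sum_closed; [exact: mulI0|exact: mulID|move=> i].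
rewrite -mulrA mulrC; apply: mulI_mem => //.
by have [c Bc <-] := Bb' i; apply: loc_ord; apply: Bm.
Qed.

End Residue.

(** * The inverse topology *)

Section Topology.
Variable D : idomainType.
Implicit Types (P : Spec D) (S : set (Spec D)) (C : set D).

(** [VI] turns sums of ideals into intersections. *)
Lemma VI_bigcap (s : seq (set D)) : {in s, forall C, fin_gen C} ->
  exists2 C, fin_gen C & forall P, VI C P <-> {in s, forall C, VI C P}.
Proof.
elim: s => [|A s IH] fs.
  exists (gen_ideal [::]); first by exists [::].
  by move=> P; split=> // _; rewrite gen_nil => _ ->; apply: is_ideal0; apply: carrier_ideal.
have [C fC CE] : exists2 C, fin_gen C & forall P, VI C P <-> {in s, forall C, VI C P}.
  by apply: IH => B Bs; apply: fs; rewrite inE Bs orbT.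
have fA : fin_gen A by apply: fs; rewrite inE eqxx.
exists (addI A C); first exact: fin_gen_add.
move=> P; split=> [ACP B|H].
  rewrite inE => /orP[/eqP ->|Bs].
    by apply: subset_trans ACP; apply: addI_subl; apply: fin_gen_ideal.
  by move: B Bs; apply/CE; apply: subset_trans ACP; apply: addI_subr; apply: fin_gen_ideal.
apply: addI_sub; first exact: carrier_ideal.
  by apply: H; rewrite inE eqxx.
by apply/CE => B Bs; apply: H; rewrite inE Bs orbT.
Qed.

(** The subbasis of the inverse topology is thus a basis. *)
Lemma nbhs_Spec P S : nbhs P S <->
  exists C, [/\ fin_gen C, C `<=` carrier P & VI C `<=` S].
Proof.
split=> [[_ [[G GE] <-] [U /[dup] /(GE _) [F Ff <-] GF FP] GS]|[C [fC CP CS]]].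
  have [|C fC CE] := @VI_bigcap (enum_fset F).
    by move=> C CF; have := Ff _ CF; rewrite inE.
  exists C; split=> //; first by apply/CE => B BF; apply: FP.
  by move=> N /CE NC; apply: GS; exists (\bigcap_(i in [set` F]) VI i).
apply: filterS CS _; exists (VI C); split=> //; exists [set VI C]; last by rewrite bigcup_set1.
move=> _ ->; exists (fset1 C); last by rewrite set_fset1 bigcap_set1.
by move=> B /fset1P ->; rewrite inE.
Qed.

End Topology.

(** * Fractional ideals as quotients *)

Section Fractions.
Variable D : idomainType.
Local Notation K := {fraction D}.
Local Notation "x %:F" := (@FracField.tofrac D x).
Implicit Types (A B C I : set D) (J : set K) (P : Spec D) (X : set (Spec D)).

(** With [I = d J] integral and [R = I + (d)], both [I] and [(d)] are multiples
    of the invertible ideal [R], say [I = R A] and [(d) = R B], and [J = A / B].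
    Outside the support of [J] the ideals [I], [(d)], [R] agree locally, so [A]
    and [B] are locally trivial. *)
Lemma Inv_quot X J : prufer D -> Inv_ X J ->
  exists A B, [/\ is_ideal A, is_ideal B, Inv_ X (toK A) & Inv_ X (toK B)] /\
    (forall j b, J j -> B b -> toK A (j * b%:F)) /\
    (forall a, A a -> mulI J (toK B) a%:F).
Proof.
move=> hD [Jinv sJ]; have [[Jmod [_ [d d0 dJ]]] _] := Jinv.
have invI := invertible_clear d0 dJ Jinv; have iI := clear_ideal d Jmod.
set I := clear_denom d J in invI iI.
have id := prin_ideal d; have iR := addI_ideal iI id; set R := addI I (prin d) in iR.
have IR : I `<=` R := @addI_subl _ _ _ id; have dR : prin d `<=` R := @addI_subr _ _ _ iI.
have fR : fin_gen R.
  by apply: fin_gen_add; [exact: inv_ideal_fin_gen|exact: fin_gen_prin].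
have invR : inv_ideal R.
  apply: invertible_toK; apply: prufer_inv => //; exists d => //; apply: dR.
  exact: prin_mem.
pose A := colon I R; pose B := colon (prin d) R.
have RA : mulI R A = I := inv_ideal_dvd invR iI IR.
have RB : mulI R B = prin d := inv_ideal_dvd invR id dR.
have iA : is_ideal A by apply: colon_ideal.
have iB : is_ideal B by apply: colon_ideal.
have IB : mulI I B = mulI A (prin d).
  by rewrite -RA -RB (mulIC R A) mulIA.
have supp_local P : ~ X P -> ~ A `<=` carrier P /\ ~ B `<=` carrier P.
  move=> nXP; have JP : mulI J (setloc P) = setloc P.
    by apply: contrapT => H; apply: nXP; apply: sJ.
  (* [J D_P = D_P] puts [R] inside [d D_P]: this gives an element [s] of [B]. *)
  have [s sP sR] : exists2 s, ~ carrier P s & forall x, R x -> prin d (s * x).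
    apply: fin_gen_local => // _ [a [_ [[j Jj aE] [c ->] ->]]].
    have : setloc P j.
      rewrite -JP -[j]mulr1; apply: mulI_mem => //.
      by rewrite /setloc /= rpred1.
    move=> /asboolP[b [t [/negP tP jE]]]; exists t => //.
    exists (b + t * c); apply/eqP; rewrite -tofrac_eq.
    rewrite !(tofracM, tofracD) aE jE !mulrDr; apply/eqP; congr (_ + _).
      by rewrite mulrCA; congr (_ * _); rewrite mulrC divfK// (@notin_neq0 _ P).
    by rewrite mulrCA.
  have Bs : B s by move=> x /sR; rewrite mulrC.
  (* It also puts [d] inside [I D_P], which makes [s * t] an element of [A]. *)
  have [t [tP It]] : exists t, ~ carrier P t /\ I (d * t).
    have : setloc P 1 by rewrite /setloc /= rpred1.
    rewrite -JP (mulI_setloc _ Jmod) => -[j [t [Jj tP /esym E]]].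
    exists t; split=> //; exists j => //; rewrite tofracM; congr (_ * _).
    by move: E => /(canRL (divfK (notin_neq0 tP))); rewrite mul1r.
  split; last by move=> /(_ _ Bs).
  move=> /(_ (s * t)) H; apply: (carrierM sP tP); apply: H => x /sR[c E].
  by rewrite mulrA [x * s]mulrC E mulrAC; apply: is_idealMr.
have AX : VI A `<=` X.
  by move=> P PA; apply: contrapT => /supp_local[]; case.
have BX : VI B `<=` X.
  by move=> P PB; apply: contrapT => /supp_local[_]; case.
have invA : inv_ideal A by apply: (inv_ideal_factor iR); rewrite RA.
have invB : inv_ideal B by apply: (inv_ideal_factor iR); rewrite RB; apply: inv_ideal_prin.
exists A, B; split; first by split=> //; apply/Inv_toK.
have dF0 : d%:F != 0 by rewrite tofrac_eq0.
split=> [j b Jj Bb|a Aa].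
  have [c _ cE] := dJ _ Jj.
  have : mulI I B (c * b) by apply: mulI_mem => //; exists j.
  rewrite IB => H.
  have [a Aa E] : exists2 a, A a & c * b = a * d.
    move: H; apply: (@mulI_sub _ _ _ [set x | exists2 a, A a & x = a * d]) => /=.
    - by exists 0; [exact: is_ideal0|rewrite mul0r].
    - by move=> _ _ [x Ax ->] [y Ay ->]; exists (x + y); [exact: (is_idealD iA)|rewrite mulrDl].
    - move=> x _ Ax [e ->]; exists (x * e); first exact: (is_idealMr _ iA).
      by rewrite mulrA mulrAC.
  exists a => //; apply: (mulfI dF0).
  by rewrite mulrA -cE -!tofracM E mulrC.
have : mulI I B (a * d) by rewrite IB; apply: mulI_mem => //; apply: prin_mem.
move=> [n [i [b [Ii Bb E]]]].
have /choice[j jE] k : exists j, J j /\ (i k)%:F = d%:F * j.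
  by have [j] := Ii k; exists j.
have -> : a%:F = \sum_k j k * (b k)%:F.
  apply: (mulfI dF0); rewrite mulrC -tofracM E rmorph_sum mulr_sumr/=.
  by apply: eq_bigr => k _; rewrite tofracM (jE k).2 mulrA.
apply: sum_closed; [exact: mulI0|exact: mulID|move=> k].
by apply: mulI_mem; [have [] := jE k|exists (b k)].
Qed.

End Fractions.

(** * Ideal functions *)

Section Main.
Variables (D : idomainType) (X : set (Spec D)).
Hypotheses (hD : prufer D) (XM : X `<=` Max D) (dX : discrete_spec X).
Local Notation K := {fraction D}.
Local Notation "x %:F" := (@FracField.tofrac D x).
Implicit Types (A B C I R : set D) (J : set K) (P M : Spec D).

Lemma nu_quot J A B P (n m : nat) : X P -> has_ord P A n -> has_ord P B m ->
  (forall j b, J j -> B b -> toK A (j * b%:F)) ->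
  (forall a, A a -> mulI J (toK B) a%:F) -> nu J P = n%:Z - m%:Z.
Proof.
move=> XP An Bm JBA AJB.
have [p [Pp P2p]] := ex_unif (dX XP).
have [Q QE] := bigcap_expI_prime hD (XM XP) Pp P2p.
have w := is_w_quot hD (XM XP) Pp P2p QE An Bm JBA AJB.
rewrite /nu; case: xgetP => [k _ wk|/(_ _ w)//]; exact: is_w_uniq wk w.
Qed.

Lemma has_ord_setT P : has_ord P setT 0.
Proof.
split=> // H; apply: (@carrier1 _ P); rewrite -(expI1 (carrier_ideal P)); exact: H.
Qed.

Lemma nu_integral I P (n : nat) : X P -> is_ideal I -> has_ord P I n -> nu (toK I) P = n%:Z.
Proof.
move=> XP iI In; rewrite (nu_quot XP In (has_ord_setT P)) ?subr0//.
  by move=> _ b [a Ia <-] _; exists (a * b); [exact: is_idealMr|rewrite tofracM].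
move=> a Ia; rewrite -[a]mulr1 tofracM; apply: mulI_mem; [by exists a|by exists 1].
Qed.

Lemma has_ord_supp I P : X P -> VI I `<=` X -> exists n, has_ord P I n.
Proof.
by move=> XP IX; apply: has_ord_ex; apply: (supp_not_sub_bigcap hD (XM XP) (dX XP) XM IX).
Qed.

(** ** Locally constant orders *)

(** Continuity on [X] of the order of [I], written on the basis of the inverse
    topology. *)
Definition loc_cst I : Prop := forall P, X P -> exists n C,
  [/\ fin_gen C, C `<=` carrier P & forall N, X N -> C `<=` carrier N -> has_ord N I n].

(** A radical ideal has order one at the maximal ideals containing it and zero at
    the others; both sets are open, the second because [P] and [R] are comaximal
    when [P] does not contain [R]. *)
Lemma loc_cst_radical R : radical_ideal R -> fin_gen R -> VI R `<=` X -> loc_cst R.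
Proof.
move=> [iR radR] fR RX P XP.
have [RP|/nonsubset[r [Rr rP]]] := pselect (R `<=` carrier P).
  exists 1%N, R; split=> // N XN RN.
  split; first by rewrite (expI1 (carrier_ideal N)).
  have [p [Np N2p]] := ex_unif (dX XN) => RN2; apply: N2p.
  have [s sN] := local_rad XM iR RX RN Np; rewrite radR => Rsp.
  by apply: (expI_primary (XM XN) sN); apply: RN2.
have [c [q [Pq E]]] := Max_coprime (XM XP) rP.
exists 0%N, (prin q); split; first exact: fin_gen_prin.
  by move=> _ [e ->]; apply: is_idealMr => //; apply: carrier_ideal.
move=> N XN qN; split=> //; rewrite (expI1 (carrier_ideal N)) => RN.
apply: (@carrier1 _ N); rewrite E; apply: is_idealD; first exact: carrier_ideal.
  by apply: is_idealMr; [exact: carrier_ideal|exact: RN].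
by apply: qN; apply: prin_mem.
Qed.

Lemma loc_cstM A B : loc_cst A -> loc_cst B -> loc_cst (mulI A B).
Proof.
move=> lA lB P XP; have [n [C [fC CP Cn]]] := lA P XP.
have [m [E [fE EP Em]]] := lB P XP.
have [iC iE] := (fin_gen_ideal fC, fin_gen_ideal fE).
exists (n + m)%N, (addI C E); split; first exact: fin_gen_add.
  by apply: addI_sub => //; apply: carrier_ideal.
move=> N XN CEN; apply: (has_ordM hD (XM XN) (dX XN)).
  by apply: Cn => //; apply: subset_trans CEN; apply: addI_subl.
by apply: Em => //; apply: subset_trans CEN; apply: addI_subr.
Qed.

Lemma loc_cst_setT : loc_cst setT.
Proof.
move=> P XP; exists 0%N, (prin 0); split; first exact: fin_gen_prin.
  by move=> _ [c ->]; rewrite mul0r; apply: is_ideal0; apply: carrier_ideal.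
by move=> N _ _; apply: has_ord_setT.
Qed.

Lemma loc_cst_prod n (R : 'I_n -> set D) :
  (forall i, radical_ideal (R i) /\ fin_gen (R i)) ->
  VI (\big[@mulI D/setT]_(i < n) R i) `<=` X ->
  loc_cst (\big[@mulI D/setT]_(i < n) R i).
Proof.
elim: n R => [|n IH] R Rr; first by rewrite big_ord0 => _; apply: loc_cst_setT.
rewrite big_ord_recl; set T := \big[_/_]_(_ < _) _ => RTX.
have iT : is_ideal T.
  apply: (big_ind (@is_ideal D)) => [|A B iA _|i _]; first exact: setT_ideal.
    exact: mulI_ideal.
  by have [[]] := Rr (lift ord0 i).
have [rR fR] := Rr ord0; have [iR _] := rR.
apply: loc_cstM.
  apply: loc_cst_radical => // P RP; apply: RTX; apply: subset_trans RP.
  exact: mulI_subl.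
apply: IH => [i|P TP]; first exact: Rr.
by apply: RTX; apply: subset_trans TP; rewrite mulIC; apply: mulI_subl.
Qed.

(** ** The four implications *)

(** The radical [C] of [I] is finitely generated because it is so locally: the [s]
    for which [s C] lies in a finitely generated ideal contained in [C] form an
    ideal, and no prime [M] contains it. If [M] does not contain [I], this is
    clear. Otherwise [M] lies in [X] and, not being critical, contains a radical
    [R] of [Inv_X(D)]; then [C] is contained in [R + I], which is locally [D_P] or
    the maximal ideal of [D_P], and some multiple [s R] with [s] outside [M] is
    contained in [C]. *)
Lemma no_crit_rad_fin_gen : Crit X = set0 ->
  forall I, proper_integral I -> Inv_ X (toK I) -> fin_gen (ideal_rad I).
Proof.
move=> noC I [iI _] /(Inv_toK _ hD iI)[invI IX].
have iC := rad_ideal iI; have [si siE] := inv_ideal_fin_gen iI invI.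
pose c := [set s | exists t : seq D, {in t, forall x, ideal_rad I x} /\
  forall x, ideal_rad I x -> gen_ideal t (s * x)].
have ic : is_ideal c.
  split.
  - by exists [::]; split=> // x _; rewrite mul0r; apply: is_ideal0; apply: gen_ideal_ideal.
  - move=> s s' [t [tC sC]] [t' [t'C s'C]]; exists (t ++ t'); split.
      by move=> x; rewrite mem_cat => /orP[/tC|/t'C].
    move=> x Cx; rewrite gen_cat mulrDl; exists (s * x), (s' * x).
    by split=> //; [apply: sC|apply: s'C].
  - move=> a s [t [tC sC]]; exists t; split=> // x Cx; rewrite -mulrA.
    by apply: is_idealMl; [exact: gen_ideal_ideal|exact: sC].
suff [t [tC sC]] : c 1.
  exists t; apply/seteqP; split; last exact: gen_sub.
  by move=> x /sC; rewrite mul1r.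
suff -> : c = setT by [].
apply: contrapT => /(exists_prime ic)[M cM].
have IM : I `<=` carrier M.
  move=> s Is; apply: cM; exists [:: s]; split.
    by move=> x; rewrite inE => /eqP ->; apply: sub_rad.
  by move=> x _; rewrite -prinE; exists x.
have XMM : X M by apply: IX.
have [R [[iR radR] /(Inv_toK _ hD iR)[invR RX] RM]] :
    exists R, [/\ radical_ideal R, Inv_ X (toK R) & R `<=` carrier M].
  apply: contrapT => nR; have : Crit X M by split=> //; apply: XM.
  by rewrite noC.
have [r rE] := inv_ideal_fin_gen iR invR.
have [s sM sR] : exists2 s, ~ carrier M s & forall x, R x -> ideal_rad I (s * x).
  apply: fin_gen_local => //; first by exists r.
  by move=> x Rx; apply: (local_rad XM iI IX IM); apply: RM.
have iRI := addI_ideal iR iI.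
have sub_rad_RI : ideal_rad I `<=` addI R I.
  move=> x [n Ixn]; apply: ideal_local => // P RIP.
  have IP : I `<=` carrier P by apply: subset_trans RIP; apply: addI_subr.
  have RP : R `<=` carrier P by apply: subset_trans RIP; apply: addI_subl.
  have Px : carrier P x by apply: (@carrierX _ _ _ n); apply: IP.
  have [e eP] := local_rad XM iR RX RP Px; rewrite radR => Rex.
  by exists e => //; apply: addI_subl.
apply: sM; apply: cM; exists ([seq s * x | x <- r] ++ si); split.
  move=> x; rewrite mem_cat => /orP[/mapP[y yr ->]|xs].
    by apply: sR; rewrite rE; apply: mem_gen.
  by apply: sub_rad; rewrite siE; apply: mem_gen.
move=> x /sub_rad_RI[y [z [Ry Iz ->]]]; rewrite mulrDr gen_cat.
have ig := gen_ideal_ideal [seq s * x | x <- r].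
exists (s * y), (s * z); split=> //; last first.
  by rewrite -siE; apply: is_idealMl.
move: Ry; rewrite rE; apply: (@gen_sub _ _ [set y | gen_ideal [seq s * x | x <- r] (s * y)]).
  split; first by rewrite /= mulr0; apply: is_ideal0.
    by move=> u v; rewrite /= mulrDr; apply: is_idealD.
  by move=> a u; rewrite /= mulrCA; apply: is_idealMl.
by move=> u ur; apply: mem_gen; apply: map_f.
Qed.

(** The radical of [I] is locally the maximal ideal, so some generator [r] of it
    lies outside [P ^ 2]. Then [r] is a uniformizer at [P], and a power of [r]
    with exponent independent of [P] lies in [I]. *)
Lemma ord_bounded I : is_ideal I -> VI I `<=` X -> fin_gen (ideal_rad I) ->
  exists n, forall P, I `<=` carrier P -> ~ I `<=` expI (carrier P) n.+1.
Proof.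
move=> iI IX [g gE].
have [n gn] : exists n, {in g, forall r, I (r ^+ n)}.
  have {gE} : {in g, forall r, ideal_rad I r} by move=> r rg; rewrite gE; apply: mem_gen.
  elim: g => [|r g IH] H; first by exists 0%N.
  have [n gn] : exists n, {in g, forall r, I (r ^+ n)}.
    by apply: IH => x xg; apply: H; rewrite inE xg orbT.
  have [m rm] := H r (mem_head _ _); exists (n + m)%N => x.
  rewrite inE exprD => /orP[/eqP ->|/gn In]; first exact: is_idealMl.
  exact: is_idealMr.
exists n => P IP IPn; have XP : X P by apply: IX.
have iP := carrier_ideal P.
have [r [rg r2]] : exists r, r \in g /\ ~ expI (carrier P) 2 r.
  apply: contrapT => H; have [p [Pp P2p]] := ex_unif (dX XP); apply: P2p.
  have [s sP] := local_rad XM iI IX IP Pp; rewrite gE => sp.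
  apply: (expI_primary (XM XP) sP); apply: gen_sub sp; first exact: expI_ideal.
  by move=> r rg; apply: contrapT => nr; apply: H; exists r.
have Pr : carrier P r by apply: (@carrierX _ _ _ n); apply: IP; apply: gn.
by apply: (unif_exp hD (XM XP) Pr r2); apply: IPn; apply: gn.
Qed.

(** Dividing [I] by its radical lowers by one the order at every prime that
    contains [I], so that after a bounded number of divisions the quotient is
    [D]. *)
Lemma rad_fin_gen_factor :
  (forall I, proper_integral I -> Inv_ X (toK I) -> fin_gen (ideal_rad I)) ->
  forall I, proper_integral I -> Inv_ X (toK I) ->
    exists (n : nat) (R : 'I_n -> set D),
      (forall i, radical_ideal (R i) /\ fin_gen (R i)) /\
      I = \big[@mulI D/setT]_(i < n) R i.
Proof.
move=> radfg I [iI IT] InvI; have [invI IX] := (Inv_toK X hD iI).1 InvI.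
have [n] := ord_bounded iI IX (radfg I (conj iI IT) InvI).
elim: n I iI IX {IT InvI} invI => [|n IH] I iI IX invI bound.
  exists 0%N, (fun=> setT); split; first by case.
  rewrite big_ord0; apply: contrapT => /(exists_prime iI)[P IP].
  by apply: (bound P IP); rewrite (expI1 (carrier_ideal P)).
have [IT|IT] := pselect (I = setT).
  by exists 0%N, (fun=> setT); split; [case|rewrite big_ord0].
have fR : fin_gen (ideal_rad I) by apply: radfg => //; apply/Inv_toK.
have iR := rad_ideal iI.
have invR : inv_ideal (ideal_rad I).
  have [a Ia a0] := inv_ideal_neq0 invI.
  by apply: invertible_toK; apply: prufer_inv => //; exists a => //; apply: sub_rad.
pose J := colon I (ideal_rad I).
have RJ : mulI (ideal_rad I) J = I := inv_ideal_dvd invR iI (@sub_rad _ I).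
have iJ : is_ideal J by apply: colon_ideal.
have IJ : I `<=` J by apply: sub_colon.
have [||P JP JPn|m [R [Rr JE]]] := IH J iJ.
- by move=> P JP; apply: IX; apply: subset_trans JP.
- by apply: (inv_ideal_factor iR); rewrite RJ.
- have IP : I `<=` carrier P by apply: subset_trans JP.
  apply: (bound P IP); rewrite -{1}RJ /expI iterS; apply: mulIS => //.
  by move=> x [k Ixk]; apply: (@carrierX _ _ _ k); apply: IP.
exists m.+1, (fun i => if unlift ord0 i is Some j then R j else ideal_rad I); split.
  by move=> i; case: unliftP => [j _|_] //; split=> //; apply: radical_rad.
rewrite big_ord_recl unlift_none -[LHS]RJ JE; congr mulI.
by apply: eq_bigr => i _; rewrite liftK.
Qed.

(** Both terms of [J = A / B] are products of radical ideals, whose orders are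
    locally constant. *)
Lemma factor_nu_continuous :
  (forall I, proper_integral I -> Inv_ X (toK I) ->
    exists (n : nat) (R : 'I_n -> set D),
      (forall i, radical_ideal (R i) /\ fin_gen (R i)) /\
      I = \big[@mulI D/setT]_(i < n) R i) ->
  forall J, Inv_ X J -> {within X, continuous (nu J)}.
Proof.
move=> factor J /(Inv_quot hD)[A [B [[iA iB InvA InvB] [JBA AJB]]]].
have cst I : is_ideal I -> Inv_ X (toK I) -> loc_cst I.
  move=> iI InvI; have [_ IX] := (Inv_toK X hD iI).1 InvI.
  have [->|IT] := pselect (I = setT); first exact: loc_cst_setT.
  have [n [R [Rr E]]] := factor I (conj iI IT) InvI.
  by rewrite E; apply: loc_cst_prod; rewrite -?E.
move=> P; have [XP|nXP] := pselect (X P); last first.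
  by move=> U /nbhs_singleton UP; rewrite /nbhs /= -nbhs_subspace_out// => _ ->.
have [n [C [fC CP Cn]]] := cst A iA InvA P XP.
have [m [E [fE EP Em]]] := cst B iB InvB P XP.
have [iC iE] := (fin_gen_ideal fC, fin_gen_ideal fE).
move=> U /nbhs_singleton UP; rewrite /nbhs /= -nbhs_subspace_in//.
apply/nbhs_Spec; exists (addI C E); split; first exact: fin_gen_add.
  by apply: addI_sub => //; apply: carrier_ideal.
have nuE N : X N -> addI C E `<=` carrier N -> nu J N = n%:Z - m%:Z.
  move=> XN CEN; apply: nu_quot JBA AJB => //.
    by apply: Cn => //; apply: subset_trans CEN; apply: addI_subl.
  by apply: Em => //; apply: subset_trans CEN; apply: addI_subr.
have CEP : addI C E `<=` carrier P by apply: addI_sub => //; apply: carrier_ideal.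
move=> N CEN XN; change (U (nu J N)).
by rewrite (nuE N XN CEN) -(nuE P XP CEP).
Qed.

(** Adding to an ideal of [Inv_X(D)] inside [M] an element of [M] outside [M ^ 2]
    gives [I] with value [1] at [M], hence with value [1] on some neighborhood
    [VI C] of [M] in [X]. Every prime [P] containing [I + C] is in this
    neighborhood, so [I] contains a uniformizer at [P] and [I + C] is locally
    [P D_P]; it is therefore radical, and [M] is not critical. *)
Lemma nu_continuous_no_crit : open X ->
  (forall J, Inv_ X J -> {within X, continuous (nu J)}) -> Crit X = set0.
Proof.
move=> oX cont; apply/seteqP; split=> // M [mM XMM]; apply.
have iM := carrier_ideal M.
have [p [Mp M2p]] := ex_unif (dX XMM).
have [I0 [fI0 I0M I0X]] := (nbhs_Spec M X).1 (open_nbhs_nbhs (conj oX XMM)).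
have inv C : C p -> fin_gen C -> inv_ideal C.
  move=> Cp fC; apply: invertible_toK; apply: prufer_inv => //.
  by exists p => //; apply: unif_neq0 M2p.
pose I := addI I0 (prin p).
have fI : fin_gen I by apply: fin_gen_add => //; apply: fin_gen_prin.
have iI := fin_gen_ideal fI.
have pI : prin p `<=` I by apply: addI_subr; apply: fin_gen_ideal.
have Ip : I p by apply: pI; apply: prin_mem.
have IM : I `<=` carrier M.
  by apply: addI_sub => // _ [c ->]; apply: is_idealMr.
have IX : VI I `<=` X.
  move=> P IP; apply: I0X; apply: subset_trans IP.
  by apply: addI_subl; apply: prin_ideal.
have invI : inv_ideal I by apply: inv.
have nuM : nu (toK I) M = 1.
  apply: (@nu_integral _ _ 1) => //; split; first by rewrite (expI1 iM).
  by move=> /(_ _ Ip).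
have /(_ M) := cont (toK I) ((Inv_toK X hD iI).2 (conj invI IX)).
have nb : nbhs (nu (toK I) M) [set nu (toK I) M] by [].
move=> /(_ _ nb); rewrite /nbhs /= -nbhs_subspace_in// => /nbhs_Spec[C [fC CM nuC]].
have iC := fin_gen_ideal fC.
have fIC : fin_gen (addI I C) by apply: fin_gen_add.
have iIC := addI_ideal iI iC.
have ICI : I `<=` addI I C by apply: addI_subl.
have ICC : C `<=` addI I C by apply: addI_subr.
have ICX : VI (addI I C) `<=` X by move=> P ICP; apply: IX; apply: subset_trans ICP.
exists (addI I C); split; last by apply: addI_sub.
- split=> //; apply/seteqP; split; last exact: sub_rad.
  move=> x [n xn]; apply: ideal_local => // P ICP.
  have XP : X P by apply: ICX.
  have Px : carrier P x by apply: (@carrierX _ _ _ n); apply: ICP.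
  have [k Pk] := has_ord_supp XP IX.
  have k1 : k = 1%N.
    have := nuC P (subset_trans ICC ICP) XP.
    change (nu (toK I) P = nu (toK I) M -> k = 1%N).
    by rewrite nuM (nu_integral XP iI Pk) => -[].
  rewrite k1 in Pk; have [_ /nonsubset[q [Iq P2q]]] := Pk.
  have [s [c [sP E]]] := unif_dvd hD (XM XP) P2q Px.
  by exists s => //; rewrite E; apply: is_idealMl => //; apply: ICI.
- by apply/Inv_toK => //; split=> //; apply: inv => //; apply: ICI.
Qed.

End Main.

Theorem corollary5p9 (D : idomainType) (X : set (Spec D)) :
  prufer D -> X `<=` Max D -> splitting_set X -> discrete_spec X ->
  [<-> Crit X = set0;
       forall I : set D, proper_integral I -> Inv_ X (toK I) ->
         fin_gen (ideal_rad I);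
       forall I : set D, proper_integral I -> Inv_ X (toK I) ->
         exists (n : nat) (R : 'I_n -> set D),
           (forall i, radical_ideal (R i) /\ fin_gen (R i)) /\
           I = \big[@mulI D/setT]_(i < n) R i;
       forall J : set {fraction D}, Inv_ X J ->
         {within X, continuous (nu J)}].
Proof.
move=> hD XM [_ oX] dX; tfae.
- exact: no_crit_rad_fin_gen.
- exact: rad_fin_gen_factor.
- exact: factor_nu_continuous.
- exact: nu_continuous_no_crit.
Qed.
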